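(* Let $S_0\subseteq\mathbb{Z}^d$ be a scored finitely generated $\mathbb{N}A$-set, let $\mathbf{b}_1,\ldots,\mathbf{b}_m\in S_0$, let $\tau_1,\ldots,\tau_m$ be faces of $\mathbb{R}_{\geq 0}A$, and let $$S_m=S_0\setminus\bigcup_{i=1}^m\bigl(\mathbf{b}_i+\mathbb{Z}(A\cap\tau_i)\bigr),$$ where this expression is irredundant and $F_\sigma(S_m)=F_\sigma(S_0)$ for all facets $\sigma$ of $\mathbb{R}_{\geq 0}A$. (It is not assumed that $S_m$ is an $\mathbb{N}A$-set.) Then the ring $D(S_m)$ is right Noetherian.
   Context: $K$ is an algebraically closed field of characteristic zero. $A=\{\mathbf{a}_1,\ldots,\mathbf{a}_n\}\subset\mathbb{Z}^d$ is a finite set; $\mathbb{N}A$ and $\mathbb{Z}A$ are the monoid and the group generated by $A$. It is assumed that $\mathbb{Z}A=\mathbb{Z}^d$ and that the cone $\mathbb{R}_{\geq 0}A$ is strongly convex. For a facet (codimension one face) $\sigma$ of $\mathbb{R}_{\geq 0}A$, $F_\sigma$ is the primitive integral support function: the unique linear form on $\mathbb{R}^d$ with $F_\sigma(\mathbb{R}_{\geq 0}A)\geq 0$, $F_\sigma(\sigma)=0$, $F_\sigma(\mathbb{Z}^d)=\mathbb{Z}$. For a face $\tau$, $\mathbb{Z}(A\cap\tau)$ is the subgroup generated by $A\cap\tau$ (it is $0$ for $\tau=\{\mathbf{0}\}$). A subset $T\subseteq\mathbb{Z}^d$ is an $\mathbb{N}A$-set if $T+\mathbb{N}A\subseteq T$;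 it is finitely generated if $T=G+\mathbb{N}A$ for a finite set $G$; it is scored if $T=\bigcap_{\sigma}\{\mathbf{a}\in\mathbb{Z}^d: F_\sigma(\mathbf{a})\in F_\sigma(T)\}$, the intersection being over all facets $\sigma$. ''Irredundant'' means that none of the sets $\mathbf{b}_i+\mathbb{Z}(A\cap\tau_i)$ can be omitted from the expression. $D(\mathbb{Z}^d)=K[t_1^{\pm1},\ldots,t_d^{\pm1}]\langle\partial_1,\ldots,\partial_d\rangle$ is the ring of differential operators with Laurent polynomial coefficients, acting on $K[\mathbb{Z}^d]=K[t_1^{\pm1},\ldots,t_d^{\pm1}]$. For $T\subseteq\mathbb{Z}^d$, $K[T]=\bigoplus_{\mathbf{a}\in T}Kt^{\mathbf{a}}$ and $D(T)=\{P\in D(\mathbb{Z}^d): P(K[T])\subseteq K[T]\}$. (When $T=\mathbb{N}A$, $D(T)$ is Grothendieck's ring of differential operators of the semigroup algebra $K[\mathbb{N}A]$.) *)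

(* Defs.v *)
From HB Require Import structures.
From mathcomp Require Import all_boot all_order all_algebra finmap.
From mathcomp Require Import boolp classical_sets reals.
From mathcomp Require Import monalg.

Set Implicit Arguments.
Unset Strict Implicit.
Unset Printing Implicit Defensive.

Import Order.TTheory GRing.Theory Num.Theory.

Local Open Scope classical_set_scope.
Local Open Scope ring_scope.

Definition monoid_gen (V : zmodType) (X : set V) : set V :=
  smallest (fun H : set V => GRing.nmod_closed [in H]) X.

Definition group_gen (V : zmodType) (X : set V) : set V :=
  smallest (fun H : set V => zmod_closed [in H]) X.

Section Cone.
Variables (R : realType) (d : nat).
Implicit Types (A : {fset 'rV[int]_d}) (S C tau sigma : set 'rV[R]_d).

Definition toR (a : 'rV[int]_d) : 'rV[R]_d := map_mx intr a.

Definition cone A : set 'rV[R]_d :=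
  [set \sum_(a <- A) c a *: toR a
     | c in [set c : 'rV[int]_d -> R | forall a, 0 <= c a]].

Definition strongly_convex C : Prop := forall x, C x -> C (- x) -> x = 0.

(* [l] may be 0, so the cone is a face of itself. *)
Definition face C tau : Prop :=
  exists2 l : {scalar 'rV[R]_d},
    (forall x, C x -> 0 <= l x) & tau = [set x | C x /\ l x = 0].

(* The dimension of [S] is that of its linear span: [S] contains a basis of
   its span consisting of [k] vectors (the rows of [M]). *)
Definition has_dim S (k : nat) : Prop :=
  exists M : 'M[R]_(k, d),
    [/\ row_free M, forall i, S (row i M) & forall x, S x -> (x <= M)%MS].

Definition facet C sigma : Prop :=
  face C sigma /\ exists2 k, has_dim C k.+1 & has_dim sigma k.

Definition support_fun C sigma (F : {scalar 'rV[R]_d}) : Prop :=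
  [/\ forall x, C x -> 0 <= F x,
      forall x, sigma x -> F x = 0 &
      [set F (toR a) | a in [set: 'rV[int]_d]] =
      [set z%:~R | z in [set: int]]].

Definition image_support (F : {scalar 'rV[R]_d}) (T : set 'rV[int]_d) : set R :=
  [set F (toR a) | a in T].

Definition face_group A tau : set 'rV[int]_d :=
  group_gen [set a : 'rV[int]_d | a \in A /\ tau (toR a)].

End Cone.

Arguments toR R {d} a.
Arguments cone R {d} A x.

Definition translate (V : zmodType) (b : V) (H : set V) : set V :=
  [set b + h | h in H].

Section NASets.
Variable d : nat.
Implicit Types (A : {fset 'rV[int]_d}) (T : set 'rV[int]_d).

Definition NA A : set 'rV[int]_d := monoid_gen [set a | a \in A].
Definition ZA A : set 'rV[int]_d := group_gen [set a | a \in A].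

Definition NA_set A T : Prop := forall t a, T t -> NA A a -> T (t + a).

Definition NA_fin_gen A T : Prop :=
  exists G : {fset 'rV[int]_d},
    T = [set t | exists g a, [/\ g \in G, NA A a & t = g + a]].

(* When ZA = Z^d, each facet has exactly one [support_fun]. *)
Definition scored (R : realType) A T : Prop :=
  T = [set a | forall (sigma : set 'rV[R]_d) (F : {scalar 'rV[R]_d}),
         facet (cone R A) sigma -> support_fun (cone R A) sigma F ->
         image_support F T (F (toR R a))].

End NASets.

Arguments scored {d} R A T.

Definition irredundant (V : Type) (m : nat) (S : set V) (U : 'I_m -> set V) :
    Prop :=
  forall j, S `\` \bigcup_(i in [set i | i != j]) U i <>
            S `\` \bigcup_(i in [set: 'I_m]) U i.

(* [<< c *g a >>] is the monomial c t^a. *)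
Notation laurent K d := ({malg K['rV[int]_d]}).

Section Endomorphisms.
Variables (K : fieldType) (d : nat).
Local Notation L := (laurent K d).

Record lendo := LEndo { lendo_fun :> L -> L; lendo_linear : linear lendo_fun }.

HB.instance Definition _ (P : lendo) :=
  GRing.isLinear.Build K L L *:%R P (@lendo_linear P).

HB.instance Definition _ := gen_eqMixin lendo.
HB.instance Definition _ := gen_choiceMixin lendo.

Lemma lendoP (P Q : lendo) : (forall f, P f = Q f) -> P = Q.
Proof.
case: P Q => [p pl] [q ql] /= /funext pq; subst q.
by congr LEndo; apply: Prop_irrelevance.
Qed.

Fact lendo0_linear : linear (fun _ : L => 0 : L).
Proof. by move=> a f g; rewrite scaler0 addr0. Qed.
Definition lendo0 := LEndo lendo0_linear.

Fact lendo1_linear : linear (fun f : L => f).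
Proof. by []. Qed.
Definition lendo1 := LEndo lendo1_linear.

Fact lendoN_linear (P : lendo) : linear (fun f : L => - P f).
Proof. by move=> a f g; rewrite linearP opprD scalerN. Qed.
Definition lendoN P := LEndo (@lendoN_linear P).

Fact lendoD_linear (P Q : lendo) : linear (fun f : L => P f + Q f).
Proof. by move=> a f g; rewrite !linearP scalerDr addrACA. Qed.
Definition lendoD P Q := LEndo (@lendoD_linear P Q).

Fact lendoM_linear (P Q : lendo) : linear (fun f : L => P (Q f)).
Proof. by move=> a f g; rewrite !linearP. Qed.
Definition lendoM P Q := LEndo (@lendoM_linear P Q).

Fact lendoZ_linear (c : K) (P : lendo) : linear (fun f : L => c *: P f).
Proof. by move=> a f g; rewrite linearP scalerDr !scalerA mulrC. Qed.
Definition lendoZ c P := LEndo (@lendoZ_linear c P).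

Fact lendoDA : associative lendoD.
Proof. by move=> P Q S; apply: lendoP => f /=; rewrite addrA. Qed.
Fact lendoDC : commutative lendoD.
Proof. by move=> P Q; apply: lendoP => f /=; rewrite addrC. Qed.
Fact lendoD0 : left_id lendo0 lendoD.
Proof. by move=> P; apply: lendoP => f /=; rewrite add0r. Qed.
Fact lendoDN : left_inverse lendo0 lendoN lendoD.
Proof. by move=> P; apply: lendoP => f /=; rewrite addNr. Qed.

HB.instance Definition _ :=
  GRing.isZmodule.Build lendo lendoDA lendoDC lendoD0 lendoDN.

Fact lendoMA : associative lendoM.
Proof. by move=> P Q S; apply: lendoP. Qed.
Fact lendoM1l : left_id lendo1 lendoM.
Proof. by move=> P; apply: lendoP. Qed.
Fact lendoM1r : right_id lendo1 lendoM.
Proof. by move=> P; apply: lendoP. Qed.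
Fact lendoMDl : left_distributive lendoM +%R.
Proof. by move=> P Q S; apply: lendoP. Qed.
Fact lendoMDr : right_distributive lendoM +%R.
Proof. by move=> P Q S; apply: lendoP => f /=; rewrite linearD. Qed.
Fact lendo1_neq0 : lendo1 != 0.
Proof.
apply/eqP => /(congr1 (fun P : lendo => (P << (0 : 'rV[int]_d) >>)@_0)) /=.
by rewrite mcoeffUU mcoeff0 => /eqP; rewrite oner_eq0.
Qed.

HB.instance Definition _ := GRing.Zmodule_isNzRing.Build lendo
  lendoMA lendoM1l lendoM1r lendoMDl lendoMDr lendo1_neq0.

Fact lendoZA a b P : lendoZ a (lendoZ b P) = lendoZ (a * b) P.
Proof. by apply: lendoP => f /=; rewrite scalerA. Qed.
Fact lendoZ1 : left_id 1 lendoZ.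
Proof. by move=> P; apply: lendoP => f /=; rewrite scale1r. Qed.
Fact lendoZDr : right_distributive lendoZ +%R.
Proof. by move=> a P Q; apply: lendoP => f /=; rewrite scalerDr. Qed.
Fact lendoZDl P : {morph lendoZ^~ P : a b / a + b}.
Proof. by move=> a b; apply: lendoP => f /=; rewrite scalerDl. Qed.

HB.instance Definition _ := GRing.Zmodule_isLmodule.Build K lendo
  lendoZA lendoZ1 lendoZDr lendoZDl.

Fact lendoZAl (a : K) (P Q : lendo) : a *: (P * Q) = (a *: P) * Q.
Proof. exact: lendoP. Qed.
HB.instance Definition _ := GRing.Lmodule_isLalgebra.Build K lendo lendoZAl.

Fact lendoZAr (a : K) (P Q : lendo) : a *: (P * Q) = P * (a *: Q).
Proof. by apply: lendoP => f; rewrite /= linearZ. Qed.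
HB.instance Definition _ := GRing.Lalgebra_isAlgebra.Build K lendo lendoZAr.

Lemma lendo_addE (P Q : lendo) f : (P + Q) f = P f + Q f. Proof. by []. Qed.
Lemma lendo_oppE (P : lendo) f : (- P) f = - P f. Proof. by []. Qed.
Lemma lendo_mulE (P Q : lendo) f : (P * Q) f = P (Q f). Proof. by []. Qed.
Lemma lendo_oneE f : (1 : lendo) f = f. Proof. by []. Qed.

Section MonomialExtension.
Variable phi : 'rV[int]_d -> L.

Definition mon_ext (f : L) : L := \sum_(a <- msupp f) f@_a *: phi a.

Lemma mon_extEw (X : {fset 'rV[int]_d}) f :
  (msupp f `<=` X)%fset -> mon_ext f = \sum_(a <- X) f@_a *: phi a.
Proof.
move=> fX; rewrite /mon_ext (big_fset_incl _ fX) // => a _ /mcoeff_outdom ->.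
by rewrite scale0r.
Qed.

Fact mon_ext_linear : linear mon_ext.
Proof.
move=> c f g; pose X := (msupp (c *: f + g) `|` (msupp f `|` msupp g))%fset.
rewrite (@mon_extEw X (c *: f + g)) ?fsubsetUl //.
rewrite (@mon_extEw X f); last by rewrite /X fsetUCA fsubsetUl.
rewrite (@mon_extEw X g); last by rewrite /X fsetUA fsubsetUr.
rewrite scaler_sumr -big_split /=; apply: eq_bigr => a _.
by rewrite mcoeffD mcoeffZ scalerDl scalerA.
Qed.

Definition lendo_mon := LEndo mon_ext_linear.

Lemma lendo_monU a : lendo_mon << a >> = phi a.
Proof.
rewrite /= (@mon_extEw [fset a]%fset) ?msuppU_le //.
by rewrite big_seq_fset1 mcoeffUU scale1r.
Qed.

End MonomialExtension.

Definition tpow (c : 'rV[int]_d) : lendo := lendo_mon (fun a => << c + a >>).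

(* d/dt_i maps t^a to a_i t^(a - e_i). *)
Definition partial (i : 'I_d) : lendo :=
  lendo_mon (fun a => << (a 0 i)%:~R *g a - delta_mx 0 i >>).

(* The algebra generated by the t_i^{+-1} and the d/dt_i inside the
   endomorphisms. When K has characteristic zero, the Weyl-type algebra
   K[t_1^{+-1}, ..., t_d^{+-1}]<d/dt_1, ..., d/dt_d> acts faithfully on the
   Laurent polynomials, and is identified here with its image. *)
Definition diffop : set lendo :=
  smallest (fun M : set lendo => subalg_closed [in M])
    [set P | exists i : 'I_d,
       [\/ P = tpow (delta_mx 0 i), P = tpow (- delta_mx 0 i)
         | P = partial i]].

Variable T : set 'rV[int]_d.

Definition laurent_on : set L := [set f | forall a, a \in msupp f -> T a].

Definition diffop_on_pred (P : lendo) : bool :=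
  `[< diffop P /\ forall f, laurent_on f -> laurent_on (P f) >].

Fact diffop_on_subring : subring_closed diffop_on_pred.
Proof.
have cl : subring_closed [in diffop].
  split.
  - by rewrite inE => M [[M1 _ _] _]; move: M1; rewrite inE.
  - move=> P Q; rewrite !inE => dP dQ M MS.
    have [/GRing.subalg_closedBM[_ MB _] _] := MS; have := MB P Q.
    by rewrite !inE; apply; [apply: dP | apply: dQ].
  - move=> P Q; rewrite !inE => dP dQ M MS.
    have [[_ _ MM] _] := MS; have := MM P Q.
    by rewrite !inE; apply; [apply: dP | apply: dQ].
have [cl1 clB clM] := cl.
split.
- apply/asboolP; split=> //; by move: cl1; rewrite inE.
- move=> P Q /asboolP[dP pP] /asboolP[dQ pQ]; apply/asboolP; split.
    by have := clB P Q; rewrite !inE; apply.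
  move=> f Tf a; rewrite lendo_addE lendo_oppE -mcoeff_neq0 mcoeffB => PQ.
  have [Pa0|Pa] := eqVneq (P f)@_a 0.
    apply: (pQ f Tf); rewrite -mcoeff_neq0.
    by move: PQ; rewrite Pa0 sub0r oppr_eq0.
  by apply: (pP f Tf); rewrite -mcoeff_neq0.
- move=> P Q /asboolP[dP pP] /asboolP[dQ pQ]; apply/asboolP; split.
    by have := clM P Q; rewrite !inE; apply.
  by move=> f Tf; rewrite lendo_mulE; apply/pP/pQ.
Qed.

Record diffop_on := DiffopOn {
  diffop_on_val :> lendo;
  diffop_on_valP : diffop_on_pred diffop_on_val
}.

HB.instance Definition _ := [isSub for diffop_on_val].
HB.instance Definition _ := [Choice of diffop_on by <:].
HB.instance Definition _ := GRing.SubChoice_isSubNzRing.Build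
  lendo diffop_on_pred diffop_on diffop_on_subring.

End Endomorphisms.

Section RightNoetherian.
Variable D : nzRingType.

Definition right_ideal (I : set D) : Prop :=
  [/\ I 0, forall x y, I x -> I y -> I (x + y) & forall x r, I x -> I (x * r)].

Definition right_ideal_gen (n : nat) (g : 'I_n -> D) : set D :=
  [set \sum_(i < n) g i * r i | r in [set: 'I_n -> D]].

Definition right_noetherian : Prop :=
  forall I : set D, right_ideal I ->
    exists (n : nat) (g : 'I_n -> D), I = right_ideal_gen g.

End RightNoetherian.

(* Main.v *)
Require Import Defs.
From HB Require Import structures.
From mathcomp Require Import all_boot all_order all_algebra finmap.
From mathcomp Require Import boolp classical_sets reals.
From mathcomp Require Import monalg.
From mathcomp Require Import zify ring.

Set Implicit Arguments.
Unset Strict Implicit.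
Unset Printing Implicit Defensive.

Import Order.TTheory GRing.Theory Num.Theory.

Local Open Scope classical_set_scope.
Local Open Scope ring_scope.

(** Write [theta] for the tuple of Euler operators t_i d/dt_i. Every
    differential operator on the Laurent polynomials is a unique finite sum of
    terms f_a(theta) t^a with f_a polynomial, and it maps K[S] into itself if
    and only if f_a vanishes on (S + a) \ S for every a ([preserves_coefP]).
    Multiplying f(theta) t^a on the right by an element of D(S) of degree
    a' - a multiplies f by an arbitrary polynomial that vanishes on
    (S + a') \ (S + a). Hence, as far as terms of lowest degree are concerned,
    right ideals of D(S) are governed by the commutative ring of polynomial
    functions on the lattice.

    [right_noetherian_criterion] makes this precise by the Hilbert basis
    argument: choose a sequence of elements of a right ideal, each outside the
    right ideal generated by its predecessors and minimal with respect to the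
    width of its support. It is contradictory as soon as, for all sequences a_k
    of degrees and f_k of polynomials vanishing on (S + a_k) \ S, one can find
    along a subsequence a relation f_n = \sum_(j < n) f_j q_j where q_j vanishes
    on (S + a_n) \ (S + a_j) ([coefficients_reduce]).

    For S = S_m such a relation is found as follows
    ([facets_and_holes_reduce]). Along a subsequence each facet form F takes on
    a_k values that are constant, or increase, or decrease with large gaps. The
    hyperplanes {F = n} that meet S + a_k but not S_0, for the decreasing forms
    F, form an increasing sequence of finite sets E_k. Because S_m
    has the same F-values as S_0, it is Zariski dense in each hyperplane that it
    meets and that is parallel to a facet ([facet_levels_dense]); therefore f_k
    is divisible by the product p_k of the equations of the members of E_k, say
    f_k = p_k g_k, and q_j may be sought in the form p_n / p_j times a
    polynomial vanishing on the relevant holes b_i + a_j + Z(A, tau_i). Along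
    a further subsequence each hole either is the same for all k, in which case
    it does not matter, or is contained in the hyperplane l_i = c_ij of an
    integral form l_i, where c_ij takes distinct values for distinct j. So it
    remains to write g_n as a combination of the
    \prod_i (l_i - c_ij) g_j with j < n. That is possible in any Noetherian
    ring, because l_i - c_ij and l_i - c_ik generate the unit ideal for j <> k
    ([noetherian_separated]). *)

(** * Sequences and their subsequences *)

Definition increasing (phi : nat -> nat) : Prop :=
  {homo phi : i j / (i < j)%N}.

Lemma increasing_comp (phi psi : nat -> nat) :
  increasing phi -> increasing psi -> increasing (phi \o psi).
Proof. by move=> hphi hpsi i j ij; apply/hphi/hpsi. Qed.

Lemma increasing_leq (phi : nat -> nat) :
  increasing phi -> {homo phi : i j / (i <= j)%N}.
Proof.
by move=> hphi i j; rewrite leq_eqVlt => /predU1P[->//|/hphi/ltnW].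
Qed.

Lemma dependent_choice (T : Type) (P : seq T -> T -> Prop) :
  (forall s, exists x, P s x) ->
  exists q : nat -> T, forall n, P (mkseq q n) (q n).
Proof.
move=> /choice[nxt nxtP].
pose fix pre n := if n is n'.+1 then rcons (pre n') (nxt (pre n')) else [::].
exists (fun n => nxt (pre n)) => n.
suff -> : mkseq (fun n => nxt (pre n)) n = pre n by apply: nxtP.
by elim: n => //= n IH; rewrite mkseqS IH.
Qed.

Lemma well_founded_min (T : Type) (lt : T -> T -> Prop) (P : set T) :
  well_founded lt -> P !=set0 -> exists2 x, P x & forall y, P y -> ~ lt y x.
Proof.
move=> wf [x Px]; apply: contrapT => noM.
elim/(well_founded_ind wf): x Px => x IH Px.
by apply: noM; exists x => // y Py /IH; apply.
Qed.

Lemma well_founded_no_descent (T : Type) (lt : T -> T -> Prop) :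
  (forall u : nat -> T, ~ forall n, lt (u n.+1) (u n)) -> well_founded lt.
Proof.
move=> noD x; apply: contrapT => nx.
have stp (y : {y | ~ Acc lt y}) : exists z : {y | ~ Acc lt y}, lt (sval z) (sval y).
  apply: contrapT => /forallNP h; case: y h => y ny h; apply: (ny).
  by constructor => z zy; apply: contrapT => nz; apply: (h (exist _ z nz)).
have [f fP] := choice stp.
apply: (noD (fun n => sval (iter n f (exist _ x nx)))) => n /=.
exact: fP.
Qed.

Lemma well_founded_measure (T : Type) (mu : T -> nat) :
  well_founded (fun x y => mu x < mu y)%N.
Proof.
move=> x; have [n] := ubnP (mu x); elim: n x => [x h|n IH x xn].
  by exfalso; move: h; rewrite ltn0.
constructor=> y yx; exact: IH (leq_trans yx xn).
Qed.

(** The common part of the two basis theorems, for polynomials and for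
    differential operators; [G s] plays the role of the ideal generated by
    [s]. Minimality of the terms is what a leading term cancellation
    contradicts. *)
Lemma minimal_bad_sequence (T : eqType) (I : set T) (G : seq T -> set T)
    (lt : T -> T -> Prop) :
  well_founded lt ->
  (forall s, (forall x, x \in s -> I x) -> exists2 x, I x & ~ G s x) ->
  exists q : nat -> T, forall n,
    [/\ I (q n), ~ G (mkseq q n) (q n) &
        forall y, I y -> ~ G (mkseq q n) y -> ~ lt y (q n)].
Proof.
move=> wf noG.
pose P s x := (forall y, y \in s -> I y) ->
  [/\ I x, ~ G s x & forall y, I y -> ~ G s y -> ~ lt y x].
have [s|q qP] := @dependent_choice T P.
  have [sI|nsI] := pselect (forall y, y \in s -> I y).
    have [x0 Ix0 nGx0] := noG s sI.
    have [|x [Ix nGx] xmin] := @well_founded_min T lt [set x | I x /\ ~ G s x] wf.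
      by exists x0.
    by exists x => _; split=> // y Iy nGy; apply: xmin.
  have [//|x0 _ _] := noG [::].
  by exists x0.
exists q => n; suff sI : forall y, y \in mkseq q n -> I y by exact: (qP n sI).
elim/ltn_ind: n => n IH y /mapP[k]; rewrite mem_iota => kn ->.
by have [] := qP k (IH k kn).
Qed.

Lemma subsequence (P : seq nat -> nat -> Prop) :
  (forall s N, exists2 k, (N <= k)%N & P s k) ->
  exists2 phi, increasing phi & forall n, P (mkseq phi n) (phi n).
Proof.
move=> hP.
have [s|phi phiP] := @dependent_choice nat
    (fun s k => (forall j, j \in s -> (j < k)%N) /\ P s k).
  have [k sk Pk] := hP s (\sum_(j <- s) j.+1)%N.
  exists k; split=> // j js.
  by apply: leq_trans sk; rewrite (big_rem j) //= leq_addr.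
exists phi => [i j ij|n]; last by have [] := phiP n.
by apply: (phiP j).1; apply: map_f; rewrite mem_iota.
Qed.

(** What one may assume about a sequence after passing to a subsequence.
    Heredity is what allows finitely many such assumptions at once. *)
Definition thin (T : Type) (Q : (nat -> T) -> Prop) : Prop :=
  (forall u phi, increasing phi -> Q u -> Q (u \o phi)) /\
  (forall u, exists2 phi, increasing phi & Q (u \o phi)).

Lemma thin_and (T : Type) (Q Q' : (nat -> T) -> Prop) :
  thin Q -> thin Q' -> thin (fun u => Q u /\ Q' u).
Proof.
move=> [hQ dQ] [hQ' dQ']; split=> [u phi hphi [Qu Q'u]|u].
  by split; [apply: hQ | apply: hQ'].
have [phi hphi Qphi] := dQ u; have [psi hpsi Qpsi] := dQ' (u \o phi).
exists (phi \o psi); first exact: increasing_comp.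
by split=> //; apply: (hQ (u \o phi)).
Qed.

Lemma thin_all (T : Type) (I : eqType) (s : seq I)
    (Q : I -> (nat -> T) -> Prop) :
  (forall i, i \in s -> thin (Q i)) ->
  thin (fun u => forall i, i \in s -> Q i u).
Proof.
elim: s => [|i s IH] hQ.
  by split=> // u; exists id.
have [] := thin_and (hQ i (mem_head _ _))
  (IH (fun j js => hQ j (mem_behead (s := i :: s) js))).
move=> h d; split=> [u phi hphi Qu j|u].
  have [Qi Qs] := h u phi hphi (conj (Qu _ (mem_head _ _))
    (fun j js => Qu j (mem_behead (s := i :: s) js))).
  by rewrite inE => /predU1P[->|/Qs].
have [phi hphi [Qi Qs]] := d u; exists phi => // j.
by rewrite inE => /predU1P[->|/Qs].
Qed.

Lemma thin_forall (T : Type) (I : finType) (Q : I -> (nat -> T) -> Prop) :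
  (forall i, thin (Q i)) -> thin (fun u => forall i, Q i u).
Proof.
move=> /(fun h => @thin_all T I (enum I) Q (fun i _ => h i))[h d].
split=> [u phi hphi Qu i|u].
  by apply: (h u phi hphi (fun j _ => Qu j)); rewrite mem_enum.
by have [phi hphi Qphi] := d u; exists phi => // i; apply: Qphi; rewrite mem_enum.
Qed.

Lemma thin_comp (T T' : Type) (g : T -> T') (Q : (nat -> T') -> Prop) :
  thin Q -> thin (fun u : nat -> T => Q (g \o u)).
Proof. by move=> [h d]; split=> [u phi|u]; [apply: (h (g \o u)) | apply: (d (g \o u))]. Qed.

Lemma thin_imp (T : Type) (Q Q' : (nat -> T) -> Prop) :
  (forall u phi, increasing phi -> Q' u -> Q' (u \o phi)) ->
  (forall u, Q u -> Q' u) -> thin Q -> thin Q'.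
Proof.
move=> hQ' QQ' [_ d]; split=> // u.
by have [phi hphi Qphi] := d u; exists phi => //; apply: QQ'.
Qed.

Section IntSequences.
Variable M : nat.
Implicit Types u : nat -> int.

Definition const_seq u := forall i j, u i = u j.
Definition inc_seq u := forall i j, (i < j)%N -> u i + M%:Z <= u j.
(** The bound on the terms makes the gap also separate every term from 0; it
    can always be achieved by dropping the first terms. *)
Definition dec_seq u :=
  (forall i, u i <= - M%:Z) /\ forall i j, (i < j)%N -> u j <= u i - M%:Z.

Lemma unbounded_inc u (x0 : int) :
  (forall x : int, exists i, x < u i) ->
  exists2 phi, increasing phi &
    (forall i, x0 <= u (phi i)) /\ inc_seq (u \o phi).
Proof.
move=> ub.
have far (x : int) N : exists2 i, (N <= i)%N & x <= u i.
  pose y : int := \sum_(j < N) `|u j| + `|x|.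
  have [i yi] := ub y; exists i.
    rewrite leqNgt; apply/negP => iN; move: yi.
    rewrite ltNge /y (bigD1 (Ordinal iN)) //= => /negP; apply.
    have : 0 <= \sum_(j < N | j != Ordinal iN) `|u j| by apply: sumr_ge0.
    by move: (\sum_(j < N | _) _) => z; lia.
  move: yi; rewrite /y; have : 0 <= \sum_(j < N) `|u j| by apply: sumr_ge0.
  by move: (\sum_(j < N) _) => z; lia.
have [s N|phi hphi phiP] := @subsequence (fun s k => x0 <= u k /\
    forall j, j \in s -> u j + M%:Z <= u k).
  have [k kN kx] := far (`|x0| + \sum_(j <- s) (`|u j| + M%:Z)) N.
  exists k => //; split.
    have : 0 <= \sum_(j <- s) (`|u j| + M%:Z) by apply: sumr_ge0.
    by move: kx; move: (\sum_(j <- s) _) => z; lia.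
  move=> j js; apply: le_trans kx; rewrite (big_rem j) //=.
  have : 0 <= \sum_(j <- rem j s) (`|u j| + M%:Z) by apply: sumr_ge0.
  by move: (\sum_(j <- _) _) => z; lia.
exists phi => //; split=> [i|i j ij]; first by have [] := phiP i.
by apply: (phiP j).2; apply: map_f; rewrite mem_iota.
Qed.

Lemma finite_valued_const (u : nat -> nat) (N : nat) :
  (forall i, u i < N)%N ->
  exists2 phi, increasing phi & forall i j, u (phi i) = u (phi j).
Proof.
elim: N u => [|N IH] u uN; first by have := uN 0%N.
have [io|/existsNP[n0 /forall2NP fin]] :=
    pselect (forall n, exists2 k, (n <= k)%N & u k = N).
  have [s n|phi hphi phiP] := @subsequence (fun _ k => u k = N).
    exact: io.
  by exists phi => // i j; rewrite !phiP.
have [i|phi hphi phiP] := IH (fun i => u (n0 + i)%N).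
  have [|nu] := fin (n0 + i)%N; first by rewrite leq_addr.
  have := uN (n0 + i)%N; lia.
by exists (fun i => n0 + phi i)%N => // i j ij; rewrite ltn_add2l; apply: hphi.
Qed.

Lemma bounded_const u (b : int) :
  (forall i, `|u i| <= b) ->
  exists2 phi, increasing phi & const_seq (u \o phi).
Proof.
move=> ub.
have [i|phi hphi phiP] := @finite_valued_const (fun i => absz (u i + b)) (absz (b + b)).+1.
  have := ub i; lia.
exists phi => // i j /=; have := phiP i j; have := ub (phi i); have := ub (phi j); lia.
Qed.

Lemma thin_trichotomy : thin (fun u => [\/ const_seq u, inc_seq u | dec_seq u]).
Proof.
split=> [u phi hphi [uc|ui|[um ud]]|u].
- by apply: Or31 => i j /=.
- by apply: Or32 => i j ij /=; apply/ui/hphi.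
- by apply: Or33; split=> [i|i j ij] /=; [apply: um | apply/ud/hphi].
have [ub|/existsNP[x1 /forallNP ux1]] := pselect (forall x : int, exists i, x < u i).
  have [phi hphi [_ phii]] := unbounded_inc 0 ub.
  by exists phi => //; apply: Or32.
have [lb|/existsNP[x2 /forallNP ux2]] := pselect (forall x : int, exists i, x < - u i).
  have [phi hphi [phim phii]] := @unbounded_inc (fun i => - u i) M%:Z lb.
  exists phi => //; apply: Or33; split=> [i|i j ij] /=.
    have := phim i; lia.
  have := phii i j ij => /=; lia.
have [i|phi hphi phic] := @bounded_const u (`|x1| + `|x2|).
  have := ux1 i; have := ux2 i; lia.
by exists phi => //; apply: Or31.
Qed.

End IntSequences.

Lemma thin_nondecreasing : thin (fun u : nat -> nat => {homo u : i j / (i <= j)%N}).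
Proof.
apply: (@thin_imp _ _ _ _ _ (thin_comp Posz (thin_trichotomy 1))).
  by move=> u phi hphi hu i j ij; apply/hu/increasing_leq.
move=> u [uc|ui|[um _]] i j.
- by move=> _; have [->] := uc i j.
- by rewrite leq_eqVlt => /predU1P[->//|/ui] /=; lia.
- by have := um i => /=; lia.
Qed.

Lemma thin_const_or_inj :
  thin (fun u : nat -> int => const_seq u \/ injective u).
Proof.
apply: (@thin_imp _ _ _ _ _ (thin_trichotomy 1)).
  move=> u phi hphi [uc|ui]; first by left=> i j /=.
  right=> i j /ui; case: (ltngtP i j) => // /hphi; lia.
move=> u [uc|ui|[_ ud]]; first by left.
  by right=> i j uij; case: (ltngtP i j) => // /ui; lia.
by right=> i j uij; case: (ltngtP i j) => // /ud; lia.
Qed.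

Lemma thin_const_modulo (M : nat) : (0 < M)%N ->
  thin (fun u : nat -> int => forall i j, (M%:Z %| u i - u j)%Z).
Proof.
move=> M0.
apply: (@thin_imp _ _ _ _ _ (thin_comp (fun x => (x %% M%:Z)%Z) (thin_trichotomy (M + 2)))).
  by move=> u phi hphi uc i j /=.
move=> u h i j; rewrite -eqz_mod_dvd; apply/eqP.
have ub k : 0 <= (u k %% M%:Z)%Z < M%:Z.
  by rewrite modz_ge0 ?ltz_pmod // ?ltz_nat //; lia.
case: h => [uc|ui|[um _]]; first exact: uc.
  by have := ui 0%N 1%N erefl; have := ub 0%N; have := ub 1%N => /=; lia.
by have := um 0%N; have := ub 0%N => /=; lia.
Qed.

(** * Noetherian commutative rings *)

Section Span.
Variable A : comNzRingType.
Implicit Types (f g : nat -> A) (x y : A).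

Definition span f n x : Prop := exists c : nat -> A, x = \sum_(i < n) c i * f i.

Lemma span0 f n : span f n 0.
Proof. by exists (fun=> 0); rewrite big1 // => i _; rewrite mul0r. Qed.

Lemma spanD f n x y : span f n x -> span f n y -> span f n (x + y).
Proof.
move=> [c ->] [c' ->]; exists (fun i => c i + c' i).
by rewrite -big_split /=; apply: eq_bigr => i _; rewrite mulrDl.
Qed.

Lemma spanM f n a x : span f n x -> span f n (a * x).
Proof.
move=> [c ->]; exists (fun i => a * c i).
by rewrite mulr_sumr; apply: eq_bigr => i _; rewrite mulrA.
Qed.

Lemma spanB f n x y : span f n x -> span f n y -> span f n (x - y).
Proof. by move=> hx hy; apply: spanD => //; rewrite -mulN1r; apply: spanM. Qed.

Lemma span_gen f n i : (i < n)%N -> span f n (f i).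
Proof.
move=> lt_in; exists (fun j => (j == i)%:R).
rewrite (bigD1 (Ordinal lt_in)) //= eqxx mul1r big1 ?addr0 // => j /negPf.
by rewrite -val_eqE /= => ->; rewrite mul0r.
Qed.

Lemma span_sum f n m (F : nat -> A) :
  (forall i, (i < m)%N -> span f n (F i)) -> span f n (\sum_(i < m) F i).
Proof.
move=> hF; apply: (big_ind (span f n)); [exact: span0 | exact: spanD |].
by move=> i _; apply: hF.
Qed.

Lemma span_trans f g n m x :
  (forall i, (i < m)%N -> span f n (g i)) -> span g m x -> span f n x.
Proof.
by move=> h [c ->]; apply: (span_sum (F := fun i => c i * g i)) => i im; apply/spanM/h.
Qed.

Lemma span_mono f n m x : (n <= m)%N -> span f n x -> span f m x.
Proof.
by move=> nm; apply: span_trans => i lt_in; apply: span_gen; apply: leq_trans nm.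
Qed.

Lemma span_ext f g n x :
  (forall i, (i < n)%N -> f i = g i) -> span f n x -> span g n x.
Proof. by move=> fg; apply: span_trans => i lt_in; rewrite fg //; apply: span_gen. Qed.

(** The ascending chain condition for the ideals spanned by initial segments;
    stated for sequences, it can be applied along subsequences. *)
Definition noetherian : Prop :=
  forall f, exists n, forall k, (n <= k)%N -> span f n (f k).

(** A sequence that is not eventually generated has a subsequence whose terms
    are all outside the ideal of the terms preceding them. *)
Lemma noetherian_weak :
  (forall f, exists n, span f n (f n)) -> noetherian.
Proof.
move=> h f; apply: contrapT => /forallNP nf.
have [s N|phi hphi phiP] := @subsequence (fun s k =>
    forall x, span (f \o nth 0%N s) (size s) x -> x <> f k).
  pose M := maxn N (\sum_(j <- s) j.+1).
  have /existsNP[k /not_implyP[Mk nk]] := nf M.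
  exists k; first by apply: leq_trans Mk; rewrite leq_maxl.
  move=> x hx xk; apply: nk; rewrite -xk.
  apply: span_trans hx => i i_s; apply: span_gen.
  apply: leq_trans (leq_maxr _ _).
  by rewrite (big_rem (nth 0%N s i)) ?mem_nth //= leq_addr.
have [n hn] := h (f \o phi).
apply: (phiP n _ _ erefl); rewrite size_mkseq; apply: span_ext hn.
by move=> i lt_in /=; rewrite nth_mkseq.
Qed.

End Span.

Lemma noetherian_field (K : fieldType) : noetherian K.
Proof.
apply: noetherian_weak => f.
have [f0|f0] := eqVneq (f 0%N) 0; first by exists 0%N; rewrite f0; apply: span0.
exists 1%N; rewrite -[f 1%N](mulfVK f0); apply/spanM.
exact: span_gen.
Qed.

(** Hilbert's basis theorem: in a sequence that is bad with terms of minimal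
    size the sizes do not decrease, so that a relation between the leading
    coefficients can be lifted to a cancellation of the leading term. *)
Lemma noetherian_poly (A : comNzRingType) : noetherian A -> noetherian {poly A}.
Proof.
move=> nA f; apply: contrapT => /forallNP nf.
pose G (s : seq {poly A}) := span (nth 0 s) (size s).
pose I : set {poly A} := [set p | exists n, span f n p].
pose lt (p q : {poly A}) := (size p < size q)%N.
have wf : well_founded lt := @well_founded_measure _ (fun p : {poly A} => size p).
have [s sI|q qP] := @minimal_bad_sequence _ I G lt wf.
  have [N sN] : exists N, forall p, p \in s -> span f N p.
    elim: s sI => [|p s IH] sI; first by exists 0%N.
    have [N hN] := IH (fun x xs => sI x (mem_behead (s := p :: s) xs)).
    have [n hn] := sI p (mem_head _ _).
    exists (maxn n N) => r; rewrite inE => /predU1P[->|/hN].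
      by apply: span_mono hn; apply: leq_maxl.
    by apply: span_mono; apply: leq_maxr.
  have /existsNP[k /not_implyP[Nk nk]] := nf N.
  exists (f k); first by exists k.+1; apply: span_gen.
  by move=> hk; apply: nk; apply: span_trans hk => i i_s; apply/sN/mem_nth.
have GE n p : G (mkseq q n) p <-> span q n p.
  by rewrite /G size_mkseq; split; apply: span_ext => i ltin; rewrite nth_mkseq.
have szq i j : (i <= j)%N -> (size (q i) <= size (q j))%N.
  move=> ij; rewrite leqNgt; apply/negP => ji.
  have [_ _ /(_ (q j))] := qP i; apply=> //; first by have [] := qP j.
  move/GE => h; have [_ nj _] := qP j; apply/nj/GE.
  exact: span_mono h.
have [n /(_ n (leqnn n))[c cE]] := nA (fun i => lead_coef (q i)).
have [[N IqN] nqn qmin] := qP n.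
pose r := \sum_(i < n) (c i)%:P * 'X^(size (q n) - size (q i)) * q i.
have rspan : span q n r.
  by exists (fun i => (c i)%:P * 'X^(size (q n) - size (q i))).
have qn0 : q n != 0.
  by apply/eqP => q0; apply: nqn; apply/GE; rewrite q0; apply: span0.
apply: (qmin (q n - r)).
- have [M hM] : exists M, forall i, (i <= n)%N -> span f M (q i).
    elim: (n) => [|m [M hM]].
      by have [[M hM] _ _] := qP 0%N; exists M => i; rewrite leqn0 => /eqP->.
    have [[M' hM'] _ _] := qP m.+1; exists (maxn M M') => i.
    rewrite leq_eqVlt => /predU1P[->|/hM].
      by apply: span_mono hM'; apply: leq_maxr.
    by apply: span_mono; apply: leq_maxl.
  exists M; apply: spanB; first exact: hM.
  by apply: span_trans rspan => i /ltnW/hM.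
- move/GE => h; apply/nqn/GE; rewrite -[q n](subrK r).
  exact: spanD.
rewrite /lt; have szn : (0 < size (q n))%N by rewrite size_poly_gt0.
rewrite -(prednK szn) ltnS; apply/leq_sizeP => j.
rewrite coefB /r coef_sum leq_eqVlt => /predU1P[<-|].
  rewrite -lead_coefE cE; apply/eqP; rewrite subr_eq0; apply/eqP/eq_bigr => i _.
  have := szq i n (ltnW (ltn_ord i)).
  have qi0 : q i != 0.
    by apply/eqP => q0; have [_ nqi _] := qP i; apply: nqi; apply/GE; rewrite q0; apply: span0.
  have : (0 < size (q i))%N by rewrite size_poly_gt0.
  move=> h1 h2; rewrite -mulrA coefCM coefXnM lead_coefE.
  rewrite ifF; last by apply/negbTE; lia.
  by congr (_ * _`_ _); lia.
rewrite prednK // => jn; rewrite nth_default // sub0r big1 ?oppr0 // => i _.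
have := szq i n (ltnW (ltn_ord i)).
rewrite -mulrA coefCM coefXnM => h1; case: ifP => // h2; first by rewrite mulr0.
by rewrite nth_default ?mulr0 // -{1}(subKn h1) leq_sub2r.
Qed.

(** For every [lam] the principal ideals of the elements [lam - c j] are then
    pairwise comaximal. *)
Definition separated (A : comNzRingType) (c : nat -> A) : Prop :=
  forall j k, j <> k -> exists v, v * (c j - c k) = 1.

Lemma separated_comaximal (A : comNzRingType) (lam : A) (c : nat -> A) n k :
  separated c -> (n <= k)%N ->
  exists u v, u * (\prod_(j < n) (lam - c j)) + v * (lam - c k) = 1.
Proof.
move=> sc; elim: n => [|n IH] nk.
  by exists 1, 0; rewrite big_ord0; ring.
have [u [v uv]] := IH (ltnW nk).
have [|w wE] := sc k n; first by lia.
exists (u * w), (u * (\prod_(j < n) (lam - c j)) * - w + v); rewrite big_ord_recr /=.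
transitivity (u * (\prod_(j < n) (lam - c j)) * (w * (c k - c n)) + v * (lam - c k)); first by ring.
by rewrite wE mulr1.
Qed.

(** Let h_j be the product in the statement. For the induction step, take one
    family [lam - c j] out of h_j. The induction hypothesis for the sequence
    [(lam - c j) * g j] puts [(lam - c k) * g k] into the ideal of the first
    few [h_j * g j]. The induction hypothesis for [g] does the same for
    [s * g k], where [s] is the product of the first few [lam - c j]. For
    large [k] the elements [lam - c k] and [s] generate the unit ideal. *)
Lemma noetherian_separated (A : comNzRingType) (I : eqType) (L : seq I)
    (lam : I -> A) (c : I -> nat -> A) (g : nat -> A) :
  noetherian A -> (forall i, i \in L -> separated (c i)) ->
  exists n, forall k, (n <= k)%N ->
    span (fun j => (\prod_(i <- L) (lam i - c i j)) * g j) n (g k).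
Proof.
move=> nA; elim: L g => [|i L IH] g sc.
  have [n hn] := nA g; exists n => k nk.
  by apply: span_ext (hn k nk) => j _; rewrite big_nil mul1r.
have scL i' (h : i' \in L) : separated (c i') by apply: sc; rewrite in_cons h orbT.
have [n1 h1] := IH (fun j => (lam i - c i j) * g j) scL.
have [n2 h2] := IH g scL.
exists (maxn n1 n2) => k; rewrite geq_max => /andP[k1 k2].
set f := fun j => _; set n := maxn _ _.
have [u [v uv]] := separated_comaximal (lam i) (sc i (mem_head _ _)) k2.
rewrite -[g k]mul1r -uv mulrDl -!mulrA; apply: spanD; apply: spanM.
  have [a ->] := h2 k k2; rewrite mulr_sumr.
  apply: (big_ind (span f n)) => [||j _]; [exact: span0 | exact: spanD |].
  rewrite (bigD1 j) //=.
  set P := \prod_(_ < n2 | _) _; set Q := \prod_(_ <- L) _.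
  have -> : (lam i - c i j) * P * (a j * (Q * g j)) = P * a j * f j.
    by rewrite /f big_cons -/Q; ring.
  by apply/spanM/span_gen/(leq_trans (ltn_ord j))/leq_maxr.
apply: span_mono (leq_maxl n1 n2) _; apply: span_ext (h1 k k1) => j _.
by rewrite /f big_cons; ring.
Qed.

(** * Polynomial functions on the lattice *)

Section PolynomialFunctions.
Variables (K : fieldType) (d : nat).
Local Notation V := 'rV[int]_d.
Implicit Types (f g : V -> K) (u : 'cV[int]_d).

Inductive polyfun : (V -> K) -> Prop :=
| polyfun_cst c : polyfun (fun=> c)
| polyfun_coord i : polyfun (fun x => (x 0 i)%:~R)
| polyfunD f g : polyfun f -> polyfun g -> polyfun (fun x => f x + g x)
| polyfunM f g : polyfun f -> polyfun g -> polyfun (fun x => f x * g x).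

Lemma polyfun_sum (I : Type) (r : seq I) (P : pred I) (F : I -> V -> K) :
  (forall i, P i -> polyfun (F i)) -> polyfun (fun x => \sum_(i <- r | P i) F i x).
Proof.
move=> hF; elim: r => [|i r IH].
  by under eq_fun do rewrite big_nil; apply: polyfun_cst.
under eq_fun do rewrite big_cons; have [Pi|//] := boolP (P i).
exact: polyfunD (hF i Pi) IH.
Qed.

Lemma polyfun_prod (I : Type) (r : seq I) (P : pred I) (F : I -> V -> K) :
  (forall i, P i -> polyfun (F i)) -> polyfun (fun x => \prod_(i <- r | P i) F i x).
Proof.
move=> hF; elim: r => [|i r IH].
  by under eq_fun do rewrite big_nil; apply: polyfun_cst.
under eq_fun do rewrite big_cons; have [Pi|//] := boolP (P i).
exact: polyfunM (hF i Pi) IH.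
Qed.

Lemma polyfunN f : polyfun f -> polyfun (fun x => - f x).
Proof. by move=> hf; under eq_fun do rewrite -mulN1r; apply/polyfunM/hf/polyfun_cst. Qed.

Lemma polyfun_shift f a : polyfun f -> polyfun (fun x => f (x + a)).
Proof.
elim=> [c|i|{}f g _ hf _ hg|{}f g _ hf _ hg].
- exact: polyfun_cst.
- under eq_fun do rewrite mxE rmorphD /=; apply: polyfunD; first exact: polyfun_coord.
  exact: polyfun_cst.
- exact: polyfunD hf hg.
- exact: polyfunM hf hg.
Qed.

Definition dot (x : V) u : int := (x *m u) 0 0.

Lemma dotE x u : dot x u = \sum_i x 0 i * u i 0.
Proof. by rewrite /dot mxE. Qed.

Lemma dotD x y u : dot (x + y) u = dot x u + dot y u.
Proof. by rewrite /dot mulmxDl mxE. Qed.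
Lemma dotN x u : dot (- x) u = - dot x u.
Proof. by rewrite /dot mulNmx mxE. Qed.
Lemma dotB x y u : dot (x - y) u = dot x u - dot y u.
Proof. by rewrite dotD dotN. Qed.
Lemma dot0 u : dot 0 u = 0.
Proof. by rewrite /dot mul0mx mxE. Qed.
Lemma dotMn x n u : dot (x *+ n) u = dot x u *+ n.
Proof. by elim: n => [|n IH]; rewrite ?mulr0n ?dot0 // !mulrS dotD IH. Qed.
Lemma dotMz x (n : int) u : dot (x *~ n) u = dot x u * n.
Proof. by case: n => n; rewrite ?NegzE ?mulrNz ?dotN /= -pmulrn dotMn -mulr_natr ?mulrN natz. Qed.

Lemma polyfun_dot u : polyfun (fun x => (dot x u)%:~R).
Proof.
have -> : (fun x : V => (dot x u)%:~R : K) = fun x => \sum_i (x 0 i)%:~R * (u i 0)%:~R.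
  by apply/funext => x; rewrite dotE rmorph_sum /=; apply: eq_bigr => i _; rewrite rmorphM.
by apply: polyfun_sum => i _; apply: polyfunM; [apply: polyfun_coord | apply: polyfun_cst].
Qed.

(** The Noetherian ring behind the polynomial functions is a polynomial ring in
    [d] variables, built one variable at a time. It enters through its
    evaluation homomorphisms at lattice points. *)
Lemma noetherian_cover :
  exists (A : comNzRingType) (iota : {rmorphism K -> A})
         (ev : V -> {rmorphism A -> K}),
    [/\ noetherian A, forall x c, ev x (iota c) = c,
        forall a, polyfun (ev^~ a) &
        forall f, polyfun f -> exists a, forall x, ev x a = f x].
Proof.
suff [A [iota [ev [nA evc evp evi]]]] :
    exists (A : comNzRingType) (iota : {rmorphism K -> A})
           (ev : V -> {rmorphism A -> K}),
    [/\ noetherian A, forall x c, ev x (iota c) = c,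
        forall a, polyfun (ev^~ a) &
        forall i, i \in enum 'I_d -> exists a, forall x, ev x a = (x 0 i)%:~R].
  exists A, iota, ev; split=> // f.
  elim=> [c|i|{}f g _ [a aE] _ [b bE]|{}f g _ [a aE] _ [b bE]].
  - by exists (iota c).
  - by apply: evi; rewrite mem_enum.
  - by exists (a + b) => x; rewrite rmorphD aE bE.
  - by exists (a * b) => x; rewrite rmorphM aE bE.
elim: (enum _) => [|j s [A [iota [ev [nA evc evp evi]]]]].
  exists K, idfun, (fun=> idfun); split=> //; first exact: noetherian_field.
  by move=> a; apply: polyfun_cst.
have cj x : commr_rmorph (ev x) ((x 0 j)%:~R : K) by move=> a; apply: mulrC.
exists {poly A}, (polyC \o iota), (fun x => horner_morph (cj x)); split.
- exact: noetherian_poly.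
- by move=> x c; rewrite /= horner_morphC.
- elim/poly_ind => [|p c IH].
    by under eq_fun do rewrite rmorph0; apply: polyfun_cst.
  under eq_fun do rewrite rmorphD rmorphM /= horner_morphX horner_morphC.
  by apply: polyfunD (evp c); apply/polyfunM/polyfun_coord.
move=> i; rewrite inE => /predU1P[->|/evi[a aE]].
  by exists 'X => x; rewrite /= horner_morphX.
by exists a%:P => x; rewrite /= horner_morphC.
Qed.

End PolynomialFunctions.

(** * Differential operators and their coefficients *)

(** The operator f(theta) t^a. Placing the coefficient to the left of t^a
    makes the vanishing conditions that define D(S) conditions on subsets of
    translates of [S]. *)
HB.lock Definition mono (K : fieldType) (d : nat) (a : 'rV[int]_d)
    (f : 'rV[int]_d -> K) : lendo K d :=
  lendo_mon (fun b => << f (a + b) *g a + b >>).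

(** The polynomial f_a of [P], a sum of operators f_a(theta) t^a, read off as
    a function on the lattice. *)
HB.lock Definition coef (K : fieldType) (d : nat) (P : lendo K d)
    (a x : 'rV[int]_d) : K := (P << x - a >>)@_x.

Section Operators.
Variables (K : fieldType) (d : nat).
Local Notation V := 'rV[int]_d.
Local Notation L := (laurent K d).
Implicit Types (P Q : lendo K d) (a b c x : V) (f g : V -> K).

Lemma coefE P a x : coef P a x = (P << x - a >>)@_x.
Proof. by rewrite coef.unlock. Qed.

Lemma monalgUZ (z : K) a : << z *g a >> = z *: << a >> :> L.
Proof.
apply/malgP => k; rewrite mcoeffU.
have -> : (z *: << a >> : L)@_k = z * << a >>@_k by apply: mcoeffZ.
by rewrite mcoeffU; case: (a == k); rewrite ?mulr1 ?mulr0.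
Qed.

Lemma lendo_sum (I : Type) (r : seq I) (F : I -> lendo K d) h :
  (\sum_(i <- r) F i) h = \sum_(i <- r) F i h.
Proof.
elim: r => [|i r IH]; first by rewrite !big_nil.
by rewrite !big_cons lendo_addE IH.
Qed.

Lemma lendo_expand P (h : L) : P h = \sum_(b <- msupp h) h@_b *: P << b >>.
Proof.
rewrite [in LHS](monalgE h) linear_sum; apply: eq_bigr => b _.
by rewrite monalgUZ linearZ.
Qed.

Lemma lendo_ext P Q : (forall b, P << b >> = Q << b >>) -> P = Q.
Proof.
move=> PQ; apply: lendoP => h; rewrite !lendo_expand.
by apply: eq_bigr => b _; rewrite PQ.
Qed.

Lemma mcoeff_lendo P (h : L) x :
  (P h)@_x = \sum_(b <- msupp h) h@_b * coef P (x - b) x.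
Proof.
rewrite lendo_expand raddf_sum /=; apply: eq_bigr => b _.
by rewrite mcoeffZ coefE subKr.
Qed.

Lemma coef_inj P Q : (forall a x, coef P a x = coef Q a x) -> P = Q.
Proof.
move=> PQ; apply: lendoP => h; apply/malgP => x.
by rewrite !mcoeff_lendo; apply: eq_bigr => b _; rewrite PQ.
Qed.

Lemma coef0 a x : coef (0 : lendo K d) a x = 0. Proof. by rewrite coefE mcoeff0. Qed.
Lemma coefD P Q a x : coef (P + Q) a x = coef P a x + coef Q a x.
Proof. by rewrite !coefE lendo_addE mcoeffD. Qed.
Lemma coefB P Q a x : coef (P - Q) a x = coef P a x - coef Q a x.
Proof. by rewrite !coefE lendo_addE lendo_oppE mcoeffB. Qed.
Lemma coef_sum (I : Type) (r : seq I) (F : I -> lendo K d) a x :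
  coef (\sum_(i <- r) F i) a x = \sum_(i <- r) coef (F i) a x.
Proof.
rewrite coefE lendo_sum raddf_sum; apply: eq_bigr => i _; by rewrite coefE.
Qed.

Lemma monoU a f b : mono a f << b >> = << f (a + b) *g a + b >>.
Proof. by rewrite mono.unlock; apply: lendo_monU. Qed.

Lemma coef_mono a f c x : coef (mono a f) c x = if c == a then f x else 0.
Proof.
rewrite coefE monoU mcoeffU.
have -> : (a + (x - c) == x) = (c == a).
  by rewrite addrCA -subr_eq0 addrAC subrr add0r subr_eq0 eq_sym.
by case: eqP => // ->; rewrite addrC subrK.
Qed.

Lemma coef_mulr_mono P c g b x :
  coef (P * mono c g) b x = coef P (b - c) x * g (x - (b - c)).
Proof.
rewrite !coefE lendo_mulE monoU monalgUZ linearZ mcoeffZ mulrC.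
by have -> : c + (x - b) = x - (b - c) by rewrite opprB addrCA.
Qed.

Lemma mono_mul a f c g :
  mono a f * mono c g = mono (a + c) (fun x => f x * g (x - a)).
Proof.
apply: coef_inj => b x; rewrite [LHS]coef_mulr_mono [RHS]coef_mono [coef _ _ _]coef_mono.
have -> : (b - c == a) = (b == a + c) by rewrite subr_eq.
by case: eqP => [->|_]; rewrite ?addrK ?mul0r.
Qed.

Lemma mono_scale z a f : z *: mono a f = mono a (fun x => z * f x).
Proof.
apply: lendo_ext => b; rewrite monoU [RHS]monalgUZ -scalerA -monalgUZ -monoU.
by [].
Qed.

Lemma tpowU c b : tpow K c << b >> = << c + b >>.
Proof. exact: lendo_monU. Qed.

Lemma partialU (i : 'I_d) b :
  partial K i << b >> = << (b 0 i)%:~R *g b - delta_mx 0 i >>.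
Proof. exact: lendo_monU. Qed.

Lemma tpowE c : tpow K c = mono c (fun=> 1).
Proof. by apply: lendo_ext => b; rewrite monoU tpowU. Qed.

Lemma partialE (i : 'I_d) :
  partial K i = mono (- delta_mx 0 i) (fun x => (x 0 i)%:~R + 1).
Proof.
apply: lendo_ext => b; rewrite [LHS]partialU [RHS]monoU.
rewrite [- _ + b]addrC; congr << _ *g _ >>; rewrite !mxE !eqxx /=.
by rewrite rmorphB /= subrK.
Qed.

(** The normal form of a differential operator. That it describes exactly the
    elements of [diffop] follows from [diffop_polyop] and [diffop_mono]. *)
Inductive polyop : lendo K d -> Prop :=
| polyop0 : polyop 0
| polyopD a f P : polyfun f -> polyop P -> polyop (mono a f + P).

Lemma polyop_add P Q : polyop P -> polyop Q -> polyop (P + Q).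
Proof.
move=> hP hQ; elim: hP => [|a f P' hf _ IH]; first by rewrite add0r.
by rewrite -addrA; apply: polyopD.
Qed.

Lemma polyop_mono a f : polyfun f -> polyop (mono a f).
Proof. by move=> hf; rewrite -[mono a f]addr0; apply: polyopD => //; apply: polyop0. Qed.

Lemma polyop_scale z P : polyop P -> polyop (z *: P).
Proof.
elim=> [|a f P' hf _ IH]; first by rewrite scaler0; apply: polyop0.
rewrite scalerDr mono_scale; apply: polyopD => //.
by apply: polyfunM => //; apply: polyfun_cst.
Qed.

Lemma polyop_mul P Q : polyop P -> polyop Q -> polyop (P * Q).
Proof.
move=> hP hQ; elim: hP => [|a f P' hf _ IH]; first by rewrite mul0r; apply: polyop0.
rewrite mulrDl; apply: polyop_add => {IH} //.
elim: hQ => [|c g Q' hg _ IH]; first by rewrite mulr0; apply: polyop0.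
rewrite mulrDr mono_mul; apply: polyop_add => //.
by apply: polyop_mono; apply/polyfunM/polyfun_shift.
Qed.

Lemma polyop_coef P a : polyop P -> polyfun (coef P a).
Proof.
elim=> [|c f P' hf _ IH].
  have -> : coef (0 : lendo K d) a = fun=> 0 by apply/funext => x; rewrite coef0.
  exact: polyfun_cst.
have -> : coef (mono c f + P') a = fun x => (if a == c then f x else 0) + coef P' a x.
  by apply/funext => x; rewrite coefD coef_mono.
by apply: polyfunD IH; case: eqP => _ //; apply: polyfun_cst.
Qed.

Lemma polyop_support P : polyop P ->
  exists X : seq V, forall a x, coef P a x != 0 -> a \in X.
Proof.
elim=> [|c f P' hf _ [X hX]]; first by exists [::] => a x; rewrite coef0 eqxx.
exists (c :: X) => a x; rewrite coefD coef_mono inE.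
by case: (a =P c) => // _; rewrite add0r; apply: hX.
Qed.

Lemma diffop_subalg : GRing.subalg_closed [in @diffop K d].
Proof.
split.
- by rewrite inE => M [[M1 _ _] _]; move: M1; rewrite inE.
- move=> z P Q; rewrite !inE => hP hQ M hM.
  have [[_ ML _] _] := hM; have := ML z P Q; rewrite !inE.
  by apply; [apply: hP | apply: hQ].
- move=> P Q; rewrite !inE => hP hQ M hM.
  have [[_ _ MM] _] := hM; have := MM P Q; rewrite !inE.
  by apply; [apply: hP | apply: hQ].
Qed.

Lemma diffop1 : @diffop K d 1.
Proof. by have [h _ _] := diffop_subalg; move: h; rewrite inE. Qed.
Lemma diffopM P Q : diffop P -> diffop Q -> diffop (P * Q).
Proof. by have [_ _ h] := diffop_subalg; have := h P Q; rewrite !inE. Qed.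
Lemma diffopZD z P Q : diffop P -> diffop Q -> diffop (z *: P + Q).
Proof. by have [_ h _] := diffop_subalg; have := h z P Q; rewrite !inE. Qed.

Lemma diffopD P Q : diffop P -> diffop Q -> diffop (P + Q).
Proof. by move=> hP hQ; rewrite -[P]scale1r; apply: diffopZD. Qed.
Lemma diffopZ z P : diffop P -> diffop (z *: P).
Proof.
move=> hP; rewrite -[_ *: _]addr0; apply: diffopZD => //.
by rewrite -(addNr P) -scaleN1r; apply: diffopZD.
Qed.

Lemma diffop_polyop P : diffop P -> polyop P.
Proof.
apply; split.
  split.
  - rewrite inE; have -> : (1 : lendo K d) = mono (0 : V) (fun=> 1).
      by apply: lendo_ext => b; rewrite [RHS]monoU add0r lendo_oneE.
    by apply: polyop_mono; apply: polyfun_cst.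
  - by move=> z P' Q; rewrite !inE => hP hQ; apply/polyop_add/hQ/polyop_scale.
  - by move=> P' Q; rewrite !inE; apply: polyop_mul.
move=> Q [i [->|->|->]]; rewrite ?tpowE ?partialE; apply: polyop_mono.
- exact: polyfun_cst.
- exact: polyfun_cst.
- by apply: polyfunD; [apply: polyfun_coord | apply: polyfun_cst].
Qed.

Lemma diffop_gen P (i : 'I_d) :
  [\/ P = tpow K (delta_mx 0 i), P = tpow K (- delta_mx 0 i) | P = partial K i] ->
  diffop P.
Proof. by move=> h M [_]; apply; exists i. Qed.

Lemma tpowD a c : tpow K (a + c) = tpow K a * tpow K c.
Proof.
rewrite !tpowE mono_mul; congr mono; apply/funext => x; by rewrite mulr1.
Qed.

Lemma tpow0 : tpow K (0 : V) = 1.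
Proof. by apply: lendo_ext => b; rewrite tpowU add0r. Qed.

Lemma diffop_tpow a : diffop (tpow K a).
Proof.
rewrite (row_sum_delta a); apply: (big_ind (fun c => diffop (tpow K c))).
- by rewrite tpow0; apply: diffop1.
- by move=> b c hb hc; rewrite tpowD; apply: diffopM.
move=> i _; elim: (a 0 i) => [|n IH|n IH].
- by rewrite scale0r tpow0; apply: diffop1.
- rewrite intS scalerDl scale1r tpowD; apply: diffopM (IH).
  by apply: (@diffop_gen _ i); apply: Or31.
rewrite intS opprD scalerDl scaleN1r tpowD; apply: diffopM (IH).
by apply: (@diffop_gen _ i); apply: Or32.
Qed.

Lemma diffop_mono a f : polyfun f -> diffop (mono a f).
Proof.
move=> hf; have -> : mono a f = mono 0 f * tpow K a.
  rewrite tpowE mono_mul add0r; congr mono; apply/funext => x; by rewrite mulr1.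
apply: diffopM (diffop_tpow a).
elim: hf => [z|i|{}f g _ hf _ hg|{}f g _ hf _ hg].
- have -> : mono (0 : V) (fun=> z) = z *: mono (0 : V) (fun=> 1).
    by rewrite mono_scale mulr1.
  by rewrite -tpowE tpow0; apply: diffopZ; apply: diffop1.
- have -> : mono (0 : V) (fun x => (x 0 i)%:~R) = tpow K (delta_mx 0 i) * partial K i.
    rewrite tpowE partialE mono_mul subrr; congr mono; apply/funext => x.
    by rewrite mul1r !mxE !eqxx rmorphB /= subrK.
  by apply: diffopM; apply: (@diffop_gen _ i); [apply: Or31 | apply: Or33].
- have -> : mono (0 : V) (fun x => f x + g x) = mono 0 f + mono 0 g.
    apply: coef_inj => a' x.
    rewrite coefD !coef_mono.
    by case: ifP => // _; rewrite addr0.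
  exact: diffopD.
have -> : mono (0 : V) (fun x => f x * g x) = mono (0 : V) f * mono 0 g.
  by rewrite mono_mul addr0; congr mono; apply/funext => x; rewrite subr0.
exact: diffopM.
Qed.

(** The coefficient of t^x in [P] t^b is f_(x-b)(x): distinct f_a contribute
    to distinct monomials, so there is no cancellation between them. *)
Lemma preserves_coefP (S : set V) P :
  (forall h, laurent_on S h -> laurent_on S (P h)) <->
  (forall a x, S (x - a) -> ~ S x -> coef P a x = 0).
Proof.
split=> [hP a x Sxa nSx|hP h Sh x].
  have Sh : laurent_on S (<< x - a >> : L).
    by move=> b /(fsubsetP msuppU_le); rewrite inE => /eqP->.
  have [//|nz] := eqVneq (coef P a x) 0.
  by exfalso; apply/nSx/(hP _ Sh); rewrite -mcoeff_neq0 -coefE.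
rewrite -mcoeff_neq0 => Phx; apply: contrapT => nSx; move/negP: Phx; apply.
apply/eqP; rewrite mcoeff_lendo big_seq big1 // => b bh.
by rewrite hP ?mulr0 // subKr; apply: Sh.
Qed.

End Operators.

(** * A criterion for right Noetherianity *)

Section Lex.
Variable d : nat.
Local Notation V := 'rV[int]_d.
Implicit Types (u v w : V).

Definition lexlt u v : Prop :=
  exists i, u 0 i < v 0 i /\ forall j : 'I_d, (j < i)%N -> u 0 j = v 0 j.
Definition lexle u v : Prop := u = v \/ lexlt u v.
Definition cwle u v : Prop := forall i, u 0 i <= v 0 i.

Lemma lexlt_irr u : ~ lexlt u u.
Proof. by move=> [i [ui _]]; move: ui; rewrite ltxx. Qed.

Lemma lexlt_trans u v w : lexlt u v -> lexlt v w -> lexlt u w.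
Proof.
move=> [i [ui uj]] [k [vk vj]]; case: (ltngtP i k) => [ik|ki|/val_inj ik].
- by exists i; rewrite -(vj i ik); split=> // j ji; rewrite uj // vj // (ltn_trans ji).
- by exists k; rewrite (uj k ki); split=> // j jk; rewrite uj ?vj // (ltn_trans jk).
subst k; exists i; split; first exact: lt_trans ui vk.
by move=> j ji; rewrite uj ?vj.
Qed.

Lemma lexlt_total u v : [\/ u = v, lexlt u v | lexlt v u].
Proof.
have [/existsP[i0 ui0]|/existsPn uv] := boolP [exists i, u 0 i != v 0 i]; last first.
  by apply: Or31; apply/rowP => i; apply/eqP; rewrite -[_ == _]negbK.
have [i ui umin] := @arg_minnP _ i0 (fun i => u 0 i != v 0 i) (fun i : 'I_d => i : nat) ui0.
have low (j : 'I_d) : (j < i)%N -> u 0 j = v 0 j.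
  by move=> ji; apply/eqP; apply: contraTT ji => /umin; rewrite -leqNgt.
case: (ltgtP (u 0 i) (v 0 i)) ui => // ui _; [apply: Or32|apply: Or33]; exists i => //.
by split=> // j /low.
Qed.

Lemma lexltD u v w : lexlt u v -> lexlt (u + w) (v + w).
Proof.
move=> [i [ui uj]]; exists i; rewrite !mxE ltrD2r; split=> // j ji.
by rewrite !mxE uj.
Qed.

Lemma cwle_lexle u v : cwle u v -> lexle u v.
Proof.
move=> uv; have [|?|[i [vi _]]] := lexlt_total u v; [by left | by right |].
by move: vi; rewrite ltNge uv.
Qed.

Lemma lex_min (X : seq V) : X != [::] ->
  exists2 x, x \in X & forall y, y \in X -> lexle x y.
Proof.
elim: X => // a [|b X] IH _.
  by exists a; [rewrite inE | move=> y; rewrite inE => /eqP->; left].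
have [//|x xX xmin] := IH.
have [xa|xa|ax] := lexlt_total x a.
- exists x; first by rewrite in_cons xX orbT.
  by move=> y; rewrite in_cons => /predU1P[->|/xmin//]; left.
- exists x; first by rewrite in_cons xX orbT.
  by move=> y; rewrite in_cons => /predU1P[->|/xmin//]; right.
exists a; first by rewrite mem_head.
move=> y; rewrite in_cons => /predU1P[->|/xmin xy]; first by left.
by right; case: xy => [<-//|]; apply: lexlt_trans.
Qed.

Lemma thin_absz_nondecreasing :
  thin (fun u : nat -> V =>
    forall k : 'I_d, {homo (fun i => absz (u i 0 k)) : i j / (i <= j)%N}).
Proof.
exact: (thin_forall
  (fun k : 'I_d => thin_comp (fun v : V => absz (v 0 k)) thin_nondecreasing)).
Qed.

(** By Dickson's lemma an infinite lexicographic descent among vectors with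
    nonnegative entries would contain two terms [v], [w], in this order, with
    [v] below [w] coordinatewise. *)
Lemma lexlt_wf :
  well_founded (fun v w : V => [/\ cwle 0 v, cwle 0 w & lexlt v w]).
Proof.
apply: well_founded_no_descent => u ud.
have [phi hphi um] := thin_absz_nondecreasing.2 u.
have desc i n : lexlt (u (i + n.+1)%N) (u i).
  elim: n => [|n IH]; first by rewrite addn1; have [] := ud i.
  apply: lexlt_trans IH; rewrite (addnS i n.+1); by have [] := ud (i + n.+1)%N.
have le01 : cwle (u (phi 0%N)) (u (phi 1%N)).
  move=> k; have := um k 0%N 1%N erefl.
  have [_ /(_ k) h0 _] := ud (phi 0%N); have [_ /(_ k) h1 _] := ud (phi 1%N).
  by move: h0 h1; rewrite !mxE /=; lia.
have lt10 : lexlt (u (phi 1%N)) (u (phi 0%N)).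
  have := desc (phi 0%N) (phi 1%N - phi 0%N).-1.
  by have := hphi 0%N 1%N erefl; move=> h; rewrite prednK ?subn_gt0 // subnKC // ltnW.
have [e|] := cwle_lexle le01; first by move: lt10; rewrite e; apply: lexlt_irr.
by move/lexlt_trans => /(_ _ lt10); apply: lexlt_irr.
Qed.

End Lex.

Section Criterion.
Variables (K : fieldType) (d : nat) (S : set 'rV[int]_d).
Local Notation V := 'rV[int]_d.
Local Notation D := (diffop_on K S).

(** The commutative condition behind right Noetherianity: [f k] stands for the
    coefficient of t^(a k) in the k-th element of a sequence in D(S), and a
    relation [f n = \sum_j f j * q j] as below is what is needed to cancel it
    by right multiples of the previous elements. *)
Definition coefficients_reduce : Prop :=
  forall (a : nat -> V) (f : nat -> V -> K),
    (forall k, polyfun (f k)) ->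
    (forall k x, S (x - a k) -> ~ S x -> f k x = 0) ->
    exists2 phi, increasing phi & exists n (q : nat -> V -> K),
      [/\ forall j, (j < n)%N -> polyfun (q j),
          forall j x, (j < n)%N ->
            S (x - a (phi n)) -> ~ S (x - a (phi j)) -> q j x = 0 &
          forall x, f (phi n) x = \sum_(j < n) f (phi j) x * q j x].

Lemma diffop_onP (P : lendo K d) :
  diffop_on_pred S P <->
  diffop P /\ forall a x, S (x - a) -> ~ S x -> coef P a x = 0.
Proof.
by split=> [/asboolP[dP /preserves_coefP]|[dP /preserves_coefP hP]] //; apply/asboolP.
Qed.

(** [w] measures the width of the support of [P], as the complementary
    exponent of the lowest term does after homogenization in [d] extra
    variables. Only upper bounds are coordinatewise; the lower bound is
    lexicographic, so that there is one lowest term. *)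
Definition in_window (P : lendo K d) (a w : V) : Prop :=
  forall c x, coef P c x != 0 -> lexle a c /\ cwle c (a + w).

Lemma diffop_on_support (P : D) :
  exists2 X : seq V, (forall c, c \in X -> exists x, coef P c x != 0) &
    forall c x, coef P c x != 0 -> c \in X.
Proof.
have [/diffop_polyop/polyop_support[X hX] _] := (diffop_onP P).1 (valP P).
exists [seq c <- X | `[< exists x, coef P c x != 0 >]] => [c|c x cx].
  by rewrite mem_filter => /andP[/asboolP].
by rewrite mem_filter (hX _ _ cx) andbT; apply/asboolP; exists x.
Qed.

Lemma exists_window (P : D) : exists a w, cwle 0 w /\ in_window P a w.
Proof.
have [X hX XP] := diffop_on_support P.
have [X0|/lex_min[a aX amin]] := eqVneq X [::].
  exists 0, 0; split=> [i|c x /XP]; [exact: lexx | by rewrite X0].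
exists a, (\row_i \sum_(c <- X) `|c 0 i - a 0 i|); split=> [i|c x /XP cX].
  by rewrite !mxE; apply: sumr_ge0.
split; first exact: amin.
move=> i; rewrite !mxE (big_rem c) //= addrA.
have : 0 <= \sum_(y <- rem c X) `|y 0 i - a 0 i| by apply: sumr_ge0.
by move: (\sum_(y <- _) _) => z; lia.
Qed.

Lemma mono_on (a : V) (g : V -> K) : polyfun g ->
  (forall x, S (x - a) -> ~ S x -> g x = 0) -> diffop_on_pred S (mono a g).
Proof.
move=> hg ha; apply/diffop_onP; split; first exact: diffop_mono.
by move=> c x Sx nSx; rewrite coef_mono; case: eqP => // ca; apply: ha; rewrite -?ca.
Qed.

(** A bad sequence in a right ideal, minimal with respect to the width of its
    windows, is contradictory: the lexicographically lowest coefficient of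
    some term cancels against those of the previous terms, and Dickson's lemma
    makes the widths nondecreasing, so that the windows of the multiples that
    are subtracted fit into the window of that term. *)
Theorem right_noetherian_criterion : coefficients_reduce -> right_noetherian D.
Proof.
move=> red I [I0 IA IM]; apply: contrapT => nfg.
pose T := (D * V * V)%type.
pose J : set T := [set p | [/\ I p.1.1, in_window p.1.1 p.1.2 p.2 & cwle 0 p.2]].
pose G (s : seq T) (p : T) := exists r : nat -> D,
  p.1.1 = \sum_(i < size s) (nth (0, 0, 0) s i).1.1 * r i.
pose lt (p q : T) := [/\ cwle 0 p.2, cwle 0 q.2 & lexlt p.2 q.2].
have wf : well_founded lt.
  apply: well_founded_no_descent => u ud.
  have : ~ forall n, ~ Acc (fun v w : V => [/\ cwle 0 v, cwle 0 w & lexlt v w]) (u n).2.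
    by move=> /(_ 0%N); apply; apply: lexlt_wf.
  apply=> n ac; move: ac; move e : (u n).2 => v ac.
  by elim: ac n e => {}v _ IH n e; apply: (IH (u n.+1).2 _ n.+1) => //; rewrite -e; apply: ud.
have I_sum n (g r : nat -> D) : (forall i, (i < n)%N -> I (g i)) ->
    I (\sum_(i < n) g i * r i).
  by move=> hg; apply: (big_ind I) => // i _; apply/IM/hg.
have [s sJ|q qP] := @minimal_bad_sequence _ J G lt wf.
  apply: contrapT => nx; apply: nfg.
  exists (size s), (fun i => (nth (0, 0, 0) s i).1.1); apply/seteqP; split=> [P IP|P [r _ <-]].
    have [a [w [w0 win]]] := exists_window P.
    have [r rE] : G s (P, a, w) by apply: contrapT => nG; apply: nx; exists (P, a, w).
    by exists (fun i => r i).
  apply: (big_ind I) => // i _; apply: IM.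
  by have [] := sJ _ (mem_nth (0, 0, 0) (ltn_ord i)).
pose P k : D := (q k).1.1; pose a k := (q k).1.2; pose w k := (q k).2.
have IP k : I (P k) by have [[]] := qP k.
have winP k : in_window (P k) (a k) (w k) by have [[]] := qP k.
have w0 k : cwle 0 (w k) by have [[]] := qP k.
have [phi hphi wm] := proj2 (@thin_absz_nondecreasing d) w.
have dP k := (diffop_onP (P k)).1 (valP (P k)).
have [k|k x|psi hpsi [n [c [cpoly czero fE]]]] :=
  red (a \o phi) (fun k => coef (P (phi k)) (a (phi k))).
- by apply: polyop_coef; apply: diffop_polyop; case: (dP (phi k)).
- by case: (dP (phi k)) => _; apply.
pose th := phi \o psi.
have hth : increasing th by apply: increasing_comp.
have wle j : (j < n)%N -> cwle (w (th j)) (w (th n)).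
  move=> jn k; have := wm k _ _ (ltnW (hpsi _ _ jn)).
  have := w0 (th j) k; have := w0 (th n) k; rewrite /th !mxE /=; lia.
have MP j : diffop_on_pred S (if (j < n)%N then
    mono (a (th n) - a (th j)) (fun x => c j (x + a (th j))) else 0).
  case: ifP => jn; last exact: (valP (0 : D)).
  apply: mono_on => [|x]; first exact/polyfun_shift/cpoly.
  move=> Sx nSx; apply: czero => //=; last by rewrite addrK.
  by move: Sx; rewrite opprB addrA addrAC.
pose M j : D := DiffopOn (MP j).
pose P' : D := P (th n) - \sum_(j < n) P (th j) * M j.
have coefP' b x : coef P' b x = coef (P (th n)) b x -
    \sum_(j < n) coef (P (th j)) (b - a (th n) + a (th j)) x * c j (x - b + a (th n)).
  have -> : val P' = val (P (th n)) - \sum_(j < n) val (P (th j)) * val (M j).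
    rewrite /P' raddfB raddf_sum; congr (_ - _); apply: eq_bigr.
  rewrite coefB coef_sum; congr (_ - _); apply: eq_bigr => j _ /=.
  rewrite ltn_ord coef_mulr_mono opprB addrA addrAC; congr (_ * c j _).
  by rewrite !opprD !opprK !addrA subrK.
have IP' : I P'.
  rewrite /P' -mulN1r; apply: (IA) => //; rewrite mulN1r -sumrN.
  apply: (big_ind I) => [||j _]; [exact: I0 | exact: IA |].
  by rewrite -mulrN; apply: (IM).
have nG a' w' : ~ G (mkseq q (th n)) (P', a', w').
  have [h1 nGn h2] := qP (th n); move=> [r /= rE]; apply: nGn => {h1 h2}.
  pose Y (x : D) := exists r : nat -> D, x = \sum_(i < th n) P i * r i.
  have YD x y : Y x -> Y y -> Y (x + y).
    move=> [r1 ->] [r2 ->]; exists (fun i => r1 i + r2 i).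
    by rewrite -big_split; apply: eq_bigr => i _; rewrite mulrDr.
  have Y0 : Y 0 by exists (fun=> 0); rewrite big1 // => i _; rewrite mulr0.
  have YM i z : (i < th n)%N -> Y (P i * z).
    move=> lt_in; exists (fun j => if j == i then z else 0).
    rewrite (bigD1 (Ordinal lt_in)) //= eqxx big1 ?addr0 // => j /negPf.
    by rewrite -val_eqE /= => ->; rewrite mulr0.
  have [] : Y (P (th n)).
    rewrite -[P (th n)](subrK (\sum_(j < n) P (th j) * M j)) -/P'; apply: (YD).
      exists r; rewrite rE size_mkseq; apply: eq_bigr => i _.
      by rewrite nth_mkseq.
    by apply: (big_ind Y) => [||j _]; [exact: Y0 | exact: YD | apply/YM/hth].
  move=> r' r'E; exists r'; rewrite size_mkseq -/(P (th n)) r'E.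
  by apply: eq_bigr => i _; rewrite nth_mkseq.
have supp c' x : coef P' c' x != 0 -> lexlt (a (th n)) c' /\ cwle c' (a (th n) + w (th n)).
  have [->|ne] := eqVneq c' (a (th n)).
    rewrite coefP' fE subr_eq0 => /eqP[]; apply: eq_bigr => j _.
    by rewrite subrr add0r subrK.
  have strict : lexle (a (th n)) c' -> lexlt (a (th n)) c'.
    by case=> // e; rewrite e eqxx in ne.
  rewrite coefP'; have [z0|nz _] := eqVneq (coef (P (th n)) c' x) 0; last first.
    by have [h1 h2] := winP _ _ _ nz; split; [apply: strict | apply: h2].
  rewrite z0 sub0r oppr_eq0 => nz.
  have [j nzj] : exists j : 'I_n,
      coef (P (th j)) (c' - a (th n) + a (th j)) x != 0.
    apply: contrapT => /forallNP nj; move/eqP: nz; apply; rewrite big1 // => j _.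
    by have /negP := nj j; rewrite negbK => /eqP->; rewrite mul0r.
  have [h1 h2] := winP _ _ _ nzj; split.
    apply: strict; case: h1 => h1.
      by left; apply/esym/eqP; rewrite -subr_eq0; apply/eqP/(addIr (a (th j))); rewrite -h1 add0r.
    right; have := lexltD (a (th n) - a (th j)) h1.
    by rewrite -[c' - _ + _ + _]addrA [a (th j) + _]addrC !subrK.
  move=> k; have := h2 k; have := wle j (ltn_ord j) k; rewrite !mxE.
  move: (w (th j) 0 k) (w (th n) 0 k) (c' 0 k) (a (th n) 0 k) (a (th j) 0 k).
  by move=> w1 w2 c1 a1 a2; lia.
have [X hX XP] := diffop_on_support P'.
have [X0|/lex_min[a' a'X a'min]] := eqVneq X [::].
  apply: (nG 0 0); exists (fun=> 0); rewrite big1 => [|i _]; last by rewrite mulr0.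
  apply: val_inj; apply: coef_inj => c' x; rewrite /= coef0.
  by apply/eqP; apply: contraT => /XP; rewrite X0.
have [x a'x] := hX _ a'X; have [lt_a' le_a'] := supp _ _ a'x.
pose w' := a (th n) + w (th n) - a'.
have w'0 : cwle 0 w' by move=> k; have := le_a' k; rewrite /w' !mxE subr_ge0.
have [_ _ /(_ (P', a', w'))] := qP (th n); apply=> //.
  split=> //= c' y c'y; split; first exact/a'min/(XP _ y).
  by rewrite /w' addrC subrK; have [] := supp _ _ c'y.
split; [exact: w'0 | exact: w0 |].
have := lexltD (w (th n) - a') lt_a'.
by rewrite addrA -/w' [a' + _]addrC subrK.
Qed.
End Criterion.

(** * Subgroups of the lattice *)

Section GroupGen.
Variables (V : zmodType) (X : set V).

Lemma group_gen_zmod : zmod_closed [in group_gen X].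
Proof.
split=> [|x y]; first by rewrite inE => M [[M0 _] _]; move: M0; rewrite inE.
rewrite !inE => hx hy M hM; have [[_ MB] _] := hM.
by have := MB x y; rewrite !inE; apply; [apply: hx | apply: hy].
Qed.

Lemma sub_group_gen x : X x -> group_gen X x.
Proof. by move=> Xx M [_]; apply. Qed.

Lemma group_gen0 : group_gen X 0.
Proof. by have [h _] := group_gen_zmod; move: h; rewrite inE. Qed.

Lemma group_genB x y : group_gen X x -> group_gen X y -> group_gen X (x - y).
Proof. by have [_ h] := group_gen_zmod; have := h x y; rewrite !inE. Qed.

Lemma group_genN x : group_gen X x -> group_gen X (- x).
Proof.
by move=> hx; rewrite -[- x]add0r; apply: group_genB => //; apply: group_gen0.
Qed.

Lemma group_genD x y : group_gen X x -> group_gen X y -> group_gen X (x + y).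
Proof.
by move=> hx hy; rewrite -[y]opprK; apply: group_genB => //; apply: group_genN.
Qed.

Lemma group_genMn x n : group_gen X x -> group_gen X (x *+ n).
Proof.
move=> hx; elim: n => [|n IH]; first by rewrite mulr0n; apply: group_gen0.
by rewrite mulrS; apply: group_genD.
Qed.

Lemma group_genMz x z : group_gen X x -> group_gen X (x *~ z).
Proof.
by case: z => n hx; rewrite ?NegzE ?mulrNz -pmulrn; [|apply: group_genN];
  apply: group_genMn.
Qed.

Lemma group_gen_min (P : V -> Prop) :
  P 0 -> (forall x y, P x -> P y -> P (x - y)) -> (forall x, X x -> P x) ->
  forall x, group_gen X x -> P x.
Proof.
move=> P0 PB PX x; apply; split=> //; split=> [|y z]; rewrite !inE //.
exact: PB.
Qed.

Lemma monoid_gen_nmod : GRing.nmod_closed [in monoid_gen X].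
Proof.
split=> [|y z]; first by rewrite inE => M [[M0 _] _]; move: M0; rewrite inE.
rewrite !inE => hy hz M hM; have [[_ MD] _] := hM.
by have := MD y z; rewrite !inE; apply; [apply: hy | apply: hz].
Qed.

Lemma monoid_gen0 : monoid_gen X 0.
Proof. by have [h _] := monoid_gen_nmod; move: h; rewrite inE. Qed.

Lemma monoid_genD x y : monoid_gen X x -> monoid_gen X y -> monoid_gen X (x + y).
Proof. by have [_ h] := monoid_gen_nmod; have := h x y; rewrite !inE. Qed.

Lemma sub_monoid_gen x : X x -> monoid_gen X x.
Proof. by move=> Xx M [_]; apply. Qed.

Lemma monoid_genMn x n : monoid_gen X x -> monoid_gen X (x *+ n).
Proof.
move=> hx; elim: n => [|n IH]; first by rewrite mulr0n; apply: monoid_gen0.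
by rewrite mulrS; apply: monoid_genD.
Qed.

Lemma monoid_gen_min (P : V -> Prop) :
  P 0 -> (forall x y, P x -> P y -> P (x + y)) -> (forall x, X x -> P x) ->
  forall x, monoid_gen X x -> P x.
Proof.
move=> P0 PD PX x; apply; split=> //; split=> [|y z]; rewrite !inE //.
exact: PD.
Qed.

Lemma group_gen_diff x : group_gen X x ->
  exists u v, [/\ monoid_gen X u, monoid_gen X v & x = u - v].
Proof.
move: x; apply: group_gen_min
    => [|y z [u [v [hu hv ->]]] [u' [v' [hu' hv' ->]]]|y Xy].
- by exists 0, 0; rewrite subr0; split=> //; apply: monoid_gen0.
- exists (u + v'), (v + u'); split; [exact: monoid_genD..|].
  by rewrite !opprD opprK [- u' + _]addrC addrACA.
- exists y, 0; split; [exact: sub_monoid_gen | exact: monoid_gen0 |].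
  by rewrite subr0.
Qed.

End GroupGen.

Section Saturation.
Variable d : nat.
Local Notation V := 'rV[int]_d.

Lemma clear_denominators m n (Y : 'M[rat]_(m, n)) :
  exists (N : nat) (Z : 'M[int]_(m, n)),
    (0 < N)%N /\ N%:R *: Y = map_mx intr Z.
Proof.
pose D := \prod_(p : 'I_m * 'I_n) denq (Y p.1 p.2).
have D0 : 0 < D by apply: prodr_gt0 => p _; apply: denq_gt0.
exists `|D|%N, (\matrix_(i, j)
  (numq (Y i j) * \prod_(p : 'I_m * 'I_n | p != (i, j)) denq (Y p.1 p.2))).
split; first by rewrite absz_gt0 gt_eqF.
apply/matrixP => i j; rewrite !mxE rmorphM /= pmulrn gez0_abs ?ltW //.
rewrite /D (bigD1 (i, j)) //= rmorphM /= mulrAC; congr (_ * _).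
by rewrite mulrC -numqE.
Qed.

(** Over the rationals, the matrix with rows [X] has a cokernel matrix, whose
    columns cut out the span of [X], and a partial inverse, which expresses
    the vectors of the span in terms of [X]. Clearing denominators in the
    first gives the forms [Lm], in the second the multiple [M]. *)
Lemma saturation (X : seq V) :
  exists (M : nat) (Lm : 'I_d -> 'cV[int]_d),
    [/\ (0 < M)%N, forall x, x \in X -> forall s, dot x (Lm s) = 0 &
        forall x, (forall s, dot x (Lm s) = 0) ->
          group_gen [set a | a \in X] (x *+ M)].
Proof.
pose n := size X; pose Xi : 'M[int]_(n, d) := \matrix_(i < n) X`_i.
pose Xq : 'M[rat]_(n, d) := map_mx intr Xi.
have [N [C [N0 CE]]] := clear_denominators (cokermx Xq).
have [M [P [M0 PE]]] := clear_denominators (pinvmx Xq).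
have iinj m k : injective (map_mx intr : 'M[int]_(m, k) -> 'M[rat]_(m, k)).
  by move=> a b /matrixP ab; apply/matrixP => i j; have := ab i j; rewrite !mxE => /intr_inj.
have dotC x s : dot x (col s C) = (x *m C) 0 s.
  by rewrite dotE mxE; apply: eq_bigr => k _; rewrite mxE.
have ker x : (forall s, dot x (col s C) = 0) <-> (map_mx intr x <= Xq)%MS.
  rewrite submxE.
  have -> : (map_mx intr x *m cokermx Xq == 0) = (x *m C == 0).
    rewrite -(inj_eq (iinj _ _)) map_mxM map_mx0 -CE -scalemxAr scaler_eq0.
    by rewrite pnatr_eq0 -[N == _]negbK -lt0n N0.
  split=> [h|/eqP h s].
    by apply/eqP/rowP => s; rewrite -dotC h mxE.
  by rewrite dotC h mxE.
exists M, (fun s => col s C); split=> // [x xX|x /ker xq].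
  apply/ker; have lt_i : (index x X < n)%N by rewrite index_mem.
  have -> : map_mx intr x = row (Ordinal lt_i) Xq.
    by apply/rowP => j; rewrite !mxE nth_index.
  exact: row_sub.
have -> : x *+ M = (x *m P) *m Xi.
  apply: iinj; rewrite !map_mxM -PE -scalemxAr -scalemxAl mulmxKpV //.
  by apply/rowP => j; rewrite !mxE mulmxnE rmorphMn /= mulr_natl.
rewrite mulmx_sum_row; apply: (big_ind (group_gen _)) => [|y z|i _].
- exact: group_gen0.
- exact: group_genD.
rewrite -[_ 0 i]intz scaler_int; apply: group_genMz; apply: sub_group_gen.
by rewrite /= rowK; apply: mem_nth.
Qed.
End Saturation.

(** * Vanishing of polynomial functions *)

Section Vanishing.
Variables (K : fieldType) (charK : [pchar K] =i pred0) (d : nat).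
Local Notation V := 'rV[int]_d.
Implicit Types (f g : V -> K) (x y e : V) (u : 'cV[int]_d).

Lemma rowMz x (t : int) i : (x *~ t) 0 i = x 0 i * t.
Proof. by rewrite -scaler_int mxE intz mulrC. Qed.

Lemma natr_eq0_char0 n : (n%:R == 0 :> K) = (n == 0%N).
Proof. by have /pcharf0P := charK; apply. Qed.

Lemma intr_eq0_char0 z : (z%:~R == 0 :> K) = (z == 0).
Proof.
case: z => n; first by rewrite -pmulrn natr_eq0_char0.
by rewrite NegzE rmorphN /= oppr_eq0 -pmulrn natr_eq0_char0.
Qed.

Lemma intr_inj_char0 : injective (fun z : int => z%:~R : K).
Proof.
move=> z z' /eqP; rewrite -subr_eq0 -rmorphB /= intr_eq0_char0 subr_eq0.
by move/eqP.
Qed.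

Lemma poly_eq0_nat (p : {poly K}) : (forall n, p.[n%:R] = 0) -> p = 0.
Proof.
move=> p0; apply/eqP/contraT => pn0.
have := @max_poly_roots _ p [seq i%:R | i <- iota 0 (size p)] pn0.
rewrite size_map size_iota ltnn => -> //.
  by apply/allP => _ /mapP[i _ ->]; rewrite rootE p0.
rewrite map_inj_uniq ?iota_uniq // => i j ij.
apply/eqP; have := @intr_inj_char0 i%:Z j%:Z; rewrite -!pmulrn => /(_ ij) [->].
exact: eqxx.
Qed.

Lemma polyfun_line f x y : polyfun f ->
  exists p : {poly K}, forall t : int, f (x + y *~ t) = p.[t%:~R].
Proof.
elim=> [c|i|{}f g _ [p pE] _ [q qE]|{}f g _ [p pE] _ [q qE]].
- by exists c%:P => t; rewrite hornerC.
- exists ((x 0 i)%:~R%:P + (y 0 i)%:~R *: 'X) => t.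
  rewrite !hornerE mxE rmorphD /=; congr (_ + _).
  by rewrite rowMz rmorphM.
- by exists (p + q) => t; rewrite hornerD pE qE.
- by exists (p * q) => t; rewrite hornerM pE qE.
Qed.

Lemma polyfun_ray f x y : polyfun f ->
  (forall n : nat, f (x + y *+ n) = 0) -> forall t : int, f (x + y *~ t) = 0.
Proof.
move=> hf f0 t; have [p pE] := polyfun_line x y hf.
rewrite pE (@poly_eq0_nat p) ?horner0 // => n.
by rewrite -[n%:R]/(n%:Z%:~R) -pE -pmulrn.
Qed.

(** A set of lattice points that contains, with any two points, the lattice
    line through them is irreducible: polynomials in one variable form a
    domain. *)
Lemma line_irreducible (H : set V) f g :
  (forall x y t, H x -> H y -> H (x + (y - x) *~ t)) ->
  polyfun f -> polyfun g -> (forall x, H x -> f x * g x = 0) ->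
  (forall x, H x -> f x = 0) \/ (forall x, H x -> g x = 0).
Proof.
move=> Hl hf hg fg0.
have [?|/existsNP[x /not_implyP[Hx /eqP fx]]] := pselect (forall x, H x -> f x = 0).
  by left.
right=> y Hy; have [p pE] := polyfun_line x (y - x) hf.
have [q qE] := polyfun_line x (y - x) hg.
have : p * q = 0.
  apply: poly_eq0_nat => n; rewrite hornerM -[n%:R]/(n%:Z%:~R) -pE -qE.
  by apply/fg0/Hl.
move/eqP; rewrite mulf_eq0 => /orP[/eqP p0|/eqP q0].
  by move: fx; rewrite -[x]addr0 -[0](mulr0z (y - x)) pE p0 horner0 eqxx.
by rewrite -(subrKC x y) -[y - x]mulr1z qE q0 horner0.
Qed.

Lemma line_irreducible_prod (H : set V) f (I : Type) (r : seq I) (P : pred I)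
    (g : I -> V -> K) :
  (forall x y t, H x -> H y -> H (x + (y - x) *~ t)) ->
  polyfun f -> (forall i, polyfun (g i)) ->
  (forall i, P i -> exists2 x, H x & g i x != 0) ->
  (forall x, H x -> f x * \prod_(i <- r | P i) g i x = 0) ->
  forall x, H x -> f x = 0.
Proof.
move=> Hl hf hg gn0; elim: r => [|i r IH] fg0.
  by move=> x /fg0; rewrite big_nil mulr1.
have [Pi|nPi] := boolP (P i); last first.
  by apply: IH => x /fg0; rewrite big_cons (negPf nPi).
have [||x Hx|//|gi0] := @line_irreducible H
    (fun x => f x * \prod_(i <- r | P i) g i x) (g i) Hl.
- by apply: polyfunM => //; apply: polyfun_prod.
- exact: hg.
- by rewrite -mulrA [X in _ * X]mulrC; have := fg0 x Hx; rewrite big_cons Pi.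
by have [x Hx] := gn0 i Pi; rewrite gi0 ?eqxx.
Qed.

Definition level u (m : int) : set V := [set x | dot x u = m].

Lemma level_line u m x y t : level u m x -> level u m y ->
  level u m (x + (y - x) *~ t).
Proof. by rewrite /level /= dotD dotMz dotB => -> ->; rewrite subrr mul0r addr0. Qed.

Lemma polyfun_level u m : polyfun (fun x => (dot x u)%:~R - m%:~R : K).
Proof. by apply: polyfunD; [apply: polyfun_dot | apply: polyfun_cst]. Qed.

Lemma level_vanish u m x : (dot x u)%:~R - m%:~R == 0 :> K = (dot x u == m).
Proof. by rewrite -rmorphB intr_eq0_char0 subr_eq0. Qed.

(** The composite of [f] with the projection onto the hyperplane along [e] is
    zero, and it is congruent to [f] modulo the equation of the hyperplane,
    because this is so for the coordinate functions. *)
Lemma level_divides u m e f : dot e u = 1 -> polyfun f ->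
  (forall x, level u m x -> f x = 0) ->
  exists2 g, polyfun g & forall x, f x = ((dot x u)%:~R - m%:~R) * g x.
Proof.
move=> eu hf f0; pose pr x := x - e *~ (dot x u - m).
suff [g hg gE] : exists2 g, polyfun g &
    forall x, f x - f (pr x) = ((dot x u)%:~R - m%:~R) * g x.
  exists g => // x; rewrite -gE (f0 (pr x)) ?subr0 //.
  by rewrite /level /= /pr dotB dotMz eu mul1r subKr.
elim: hf {f0} => [c|i|{}f f' _ [g hg gE] _ [g' hg' gE']|
    {}f f' hf [g hg gE] hf' [g' hg' gE']].
- by exists (fun=> 0); [apply: polyfun_cst | move=> x; rewrite subrr mulr0].
- exists (fun=> (e 0 i)%:~R); [exact: polyfun_cst | move=> x].
  have -> : pr x 0 i = x 0 i - (dot x u - m) * e 0 i.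
    by rewrite /pr !mxE rowMz mulrC.
  by rewrite -!rmorphB /= subKr rmorphM.
- exists (fun x => g x + g' x); [exact: polyfunD | move=> x].
  by rewrite mulrDr -gE -gE' opprD addrACA.
exists (fun x => f x * g' x + g x * (f' x - ((dot x u)%:~R - m%:~R) * g' x)).
  apply: polyfunD; apply: polyfunM => //; apply: polyfunD => //.
  by apply: polyfunN; apply: polyfunM => //; apply: polyfun_level.
move=> x; rewrite -gE' mulrDr mulrCA -gE' mulrA -gE; ring.
Qed.

(** Distinct hyperplanes are coprime, so the product of their equations
    divides a function that vanishes on all of them. *)
Lemma levels_divide (E : seq ('cV[int]_d * int)) f :
  uniq E ->
  (forall p, p \in E -> exists e, dot e p.1 = 1) ->
  (forall p p', p \in E -> p' \in E -> p.1 <> p'.1 ->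
     exists2 y, dot y p.1 = 0 & dot y p'.1 != 0) ->
  polyfun f ->
  (forall p x, p \in E -> level p.1 p.2 x -> f x = 0) ->
  exists2 g, polyfun g &
    forall x, f x = (\prod_(p <- E) ((dot x p.1)%:~R - p.2%:~R)) * g x.
Proof.
elim: E f => [|p E IH] f uE hE hdis hf f0.
  by exists f => // x; rewrite big_nil mul1r.
have [e ep] := hE p (mem_head _ _).
have [|g hg gE] := level_divides ep hf (m := p.2).
  by move=> x; apply: f0; apply: mem_head.
move: uE => /= /andP[pE uE].
have inE' q : q \in E -> q \in p :: E by move=> qE; rewrite in_cons qE orbT.
have [q qE|q q' qE q'E|//|q x qE|h hh hE'] := IH g uE.
- by apply: hE; apply: inE'.
- by apply: hdis; apply: inE'.
- move: x; have [e' eq] := hE q (inE' q qE).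
  have [x xq|bad|//] := @line_irreducible (level q.1 q.2)
      (fun x => (dot x p.1)%:~R - p.2%:~R) g (@level_line q.1 q.2)
      (polyfun_level _ _) hg.
    by rewrite -gE; apply: f0 xq; apply: inE'.
  have badE x : level q.1 q.2 x -> dot x p.1 = p.2.
    by move/bad/eqP; rewrite level_vanish => /eqP.
  exfalso.
  have lq : level q.1 q.2 (e' *~ q.2) by rewrite /level /= dotMz eq mul1r.
  have [pq|/eqP pq] := eqVneq p.1 q.1.
    have p2 : p.2 = q.2 by rewrite -(badE _ lq) pq.
    by move: pE; rewrite (surjective_pairing p) pq p2 -surjective_pairing qE.
  have [|y yq] := hdis q p (inE' _ qE) (mem_head _ _); first by move=> qp; apply: pq.
  have lq' : level q.1 q.2 (e' *~ q.2 + y) by rewrite /level /= dotD yq addr0.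
  by have := badE _ lq'; rewrite dotD (badE _ lq) -[X in _ = X]addr0 => /addrI ->; rewrite eqxx.
exists h => // x; by rewrite big_cons gE hE' mulrA.
Qed.

End Vanishing.

(** * Cancelling coefficients *)

(** If the forms of [saturation] are constant along [a], and so are the
    coordinates modulo M, then the differences of terms are M times elements
    of the saturation, hence lie in the group. *)
Lemma thin_coset (d : nat) (X : seq 'rV[int]_d) :
  thin (fun a : nat -> 'rV[int]_d =>
    (forall j k, group_gen [set x | x \in X] (a j - a k)) \/
    exists2 l, forall x, x \in X -> dot x l = 0 &
               injective (fun k => dot (a k) l)).
Proof.
have [M [Lm [M0 XL satX]]] := saturation X.
apply: (@thin_imp _ _ _ _ _ (thin_and
  (thin_forall (fun s : 'I_d => thin_comp (fun x => dot x (Lm s)) thin_const_or_inj))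
  (thin_forall (fun i : 'I_d =>
    thin_comp (fun x : 'rV[int]_d => x 0 i) (thin_const_modulo M0))))).
  move=> a phi hphi [ha|[l lX la]]; [by left=> j k /= | right; exists l => //].
  move=> j k /la; case: (ltngtP j k) => // /hphi; lia.
move=> a [aL aM].
have [[s sinj]|noinj] := pselect (exists s, injective (fun k => dot (a k) (Lm s))).
  by right; exists (Lm s) => // x xX; apply: XL.
left=> j k.
have [y yE] : exists y, a j - a k = y *+ M.
  have /choice[y yE] : forall i, exists z, (a j - a k) 0 i = z * M%:Z.
    by move=> i; have /dvdzP[z zE] := aM i j k; exists z; rewrite -zE !mxE.
  exists (\row_i y i); apply/rowP => i; rewrite yE pmulrn rowMz.
  by rewrite mxE.
rewrite yE; apply: satX => s; have [ac|ai] := aL s; last first.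
  by exfalso; apply: noinj; exists s.
have acjk : dot (a j) (Lm s) = dot (a k) (Lm s) := ac j k.
have /eqP : dot (a j - a k) (Lm s) = 0 by rewrite dotB acjk subrr.
by rewrite yE dotMn mulrn_eq0 -[M == _]negbK -lt0n M0 => /eqP.
Qed.

Section Reduction.
Variables (K : fieldType) (charK : [pchar K] =i pred0) (d : nat).
Local Notation V := 'rV[int]_d.
Variables (S0 S : set V).

(** The facets enter through their primitive integral forms [Fs]; the set
    [vals u] of values of such a form on [S0] is bounded below and contains
    all large integers. *)
Variables (Fs : seq 'cV[int]_d) (c : 'cV[int]_d -> nat).
Definition vals u : set int := [set dot x u | x in S0].

Hypothesis prim : forall u, u \in Fs -> exists e, dot e u = 1.
Hypothesis indep : forall u u', u \in Fs -> u' \in Fs -> u <> u' ->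
  exists2 y, dot y u = 0 & dot y u' != 0.
Hypothesis S0P : forall x, (forall u, u \in Fs -> vals u (dot x u)) -> S0 x.
Hypothesis vals_ge : forall u n, u \in Fs -> vals u n -> - (c u)%:Z <= n.
Hypothesis vals_large : forall u n, u \in Fs -> (c u)%:Z <= n -> vals u n.

Variables (m : nat) (b : 'I_m -> V) (X : 'I_m -> seq V).
Definition hole i : set V := translate (b i) (group_gen [set a | a \in X i]).
Hypothesis SE : S = S0 `\` \bigcup_(i in [set: 'I_m]) hole i.

Hypothesis dense : forall u n (f : V -> K), u \in Fs -> vals u n -> polyfun f ->
  (forall x, S x -> level u n x -> f x = 0) -> forall x, level u n x -> f x = 0.

Lemma hole_shift i x y : hole i x -> group_gen [set a | a \in X i] y ->
  hole i (x + y).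
Proof.
by move=> [h hh <-] hy; exists (h + y); [apply: group_genD | rewrite addrA].
Qed.

(** Along a subsequence of [a] on which each facet form is constant,
    increasing or decreasing with gaps, write f_k = p_k g_k, where p_k is the
    product of the equations of the hyperplanes {u = n}, with u decreasing,
    that meet S + a_k but not S0. Then p_j divides p_k for j < k and p_k / p_j takes care of the
    points of S + a_k outside S0 + a_j. The remaining points of
    (S + a_k) \ (S + a_j) lie in the translates of the holes by a_j, which
    either do not move with a_j or lie in hyperplanes that are parallel and
    pairwise distinct. *)
Lemma facets_and_holes_reduce : coefficients_reduce K S.
Proof.
move=> a0 f0 f0poly f0van.
have [phi hphi [aF aX]] := proj2 (thin_and
  (thin_all (s := Fs) (fun u _ => thin_comp (fun x : V => dot x u)
     (thin_trichotomy (c u + c u))))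
  (thin_forall (fun i => thin_coset (X i)))) a0.
exists phi => //.
pose a := a0 \o phi; pose f k := f0 (phi k).
have fpoly k : polyfun (f k) by apply: f0poly.
have fvan k x : S (x - a k) -> ~ S x -> f k x = 0 by apply: f0van.
have SS0 x : S x -> S0 x by rewrite SE => -[].
pose dec u := dec_seq (c u + c u) (fun k => dot (a k) u).
pose bad k (p : 'cV[int]_d * int) :=
  [/\ p.1 \in Fs, dec p.1, ~ vals p.1 p.2 & vals p.1 (p.2 - dot (a k) p.1)].
have /choice[E EP] : forall k, exists E : seq ('cV[int]_d * int),
    uniq E /\ forall p, p \in E <-> bad k p.
  move=> k; pose rng u := [seq - (c u)%:Z + dot (a k) u + i%:Z |
    i <- iota 0 (absz ((c u)%:Z + (c u)%:Z - dot (a k) u)%R)].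
  exists (undup [seq p <- [seq (u, n) | u <- Fs, n <- rng u] | `[< bad k p >]]).
  split=> [|p]; first exact: undup_uniq.
  rewrite mem_undup mem_filter; split=> [/andP[/asboolP]//|pbad].
  apply/andP; split; first exact/asboolP.
  have [pF _ nv v] := pbad.
  apply/allpairsPdep; exists p.1, p.2; split=> //; last by case: (p).
  have ge := vals_ge pF v.
  have lt : p.2 < (c p.1)%:Z by rewrite ltNge; apply/negP => /(vals_large pF).
  apply/mapP; exists (absz (p.2 - dot (a k) p.1 + (c p.1)%:Z)%R).
    rewrite mem_iota add0n leq0n /=.
    by move: ge lt; move: (c p.1) (dot (a k) p.1) (p.2) => z1 z2 z3; lia.
  by move: ge; move: (c p.1) (dot (a k) p.1) (p.2) => z1 z2 z3; lia.
have Emono j k p : (j < k)%N -> p \in E j -> p \in E k.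
  move=> jk /(EP j).2[pF pd nv v]; apply/(EP k).2; split=> //.
  apply: vals_large => //; have := vals_ge pF v; have := pd.2 _ _ jk => /=.
  by move: (c p.1) (dot (a k) p.1) (dot (a j) p.1) (p.2) => z1 z2 z3 z4; lia.
have /choice[g gP] : forall k, exists g : V -> K, polyfun g /\
    forall x, f k x = (\prod_(p <- E k) ((dot x p.1)%:~R - p.2%:~R)) * g x.
  move=> k; have [p /(EP k).2[pF _ _ _]|p p' /(EP k).2[pF _ _ _] /(EP k).2[p'F _ _ _]|
      //|p x /(EP k).2[pF pd nv v] px|g hg gE] :=
      @levels_divide K charK d (E k) (f k) (EP k).1.
  - exact: prim.
  - exact: indep.
  - rewrite -[x](subrK (a k)).
    apply: (dense pF v (polyfun_shift (a k) (fpoly k))); last first.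
      by rewrite /level /= dotB px.
    move=> y Sy yl; apply: fvan; first by rewrite addrK.
    move=> /SS0 S0y; apply: nv; exists (y + a k) => //.
    by rewrite dotD yl subrK.
  - by exists g.
have [A [iota [ev [nA evc evp evs]]]] := noetherian_cover K d.
have /choice[ga gaE] k : exists z, forall x, ev x z = g k x.
  by apply: evs; have [] := gP k.
have /choice[l lP] i : exists l, (forall j k, group_gen [set x | x \in X i] (a j - a k)) \/
    (forall x, x \in X i -> dot x l = 0) /\ injective (fun k => dot (a k) l).
  by have [h|[l h1 h2]] := aX i; [exists 0; left | exists l; right].
pose L := [seq i <- enum 'I_m |
  ~~ `[< forall j k, group_gen [set x | x \in X i] (a j - a k) >]].
have LP i : i \in L -> (forall x, x \in X i -> dot x (l i) = 0) /\
    injective (fun k => dot (a k) (l i)).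
  by rewrite mem_filter => /andP[/asboolPn nc _]; case: (lP i).
have /choice[lam lamE] i : exists z, forall x, ev x z = (dot x (l i))%:~R.
  by apply: evs; apply: polyfun_dot.
pose cst i j : A := iota (dot (b i + a j) (l i))%:~R.
have [i iL|n /(_ n (leqnn n))[r rE]] := @noetherian_separated A _ L lam cst ga nA.
  move=> j k jk; exists (iota ((dot (a j) (l i))%:~R - (dot (a k) (l i))%:~R)^-1).
  have -> : cst i j - cst i k = iota ((dot (a j) (l i))%:~R - (dot (a k) (l i))%:~R).
    rewrite /cst !dotD [in LHS]rmorphD [in X in _ - X]rmorphD -rmorphB /=.
    by rewrite opprD addrACA subrr add0r.
  rewrite -rmorphM mulVf ?rmorph1 // subr_eq0; apply/eqP => /(intr_inj_char0 charK).
  by move/((LP i iL).2).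
pose h j x := \prod_(i <- L) ((dot x (l i))%:~R - (dot (b i + a j) (l i))%:~R) : K.
have hE j x : ev x (\prod_(i <- L) (lam i - cst i j)) = h j x.
  by rewrite rmorph_prod; apply: eq_bigr => i _; rewrite rmorphB /= lamE evc.
exists n, (fun j x => ev x (r j) * h j x *
  \prod_(p <- E n | p \notin E j) ((dot x p.1)%:~R - p.2%:~R)).
split=> [j jn|j x jn Sn nSj|x].
- apply: polyfunM; last by apply: polyfun_prod => p _; apply: polyfun_level.
  apply: polyfunM; first exact: evp.
  by apply: polyfun_prod => i _; apply: polyfun_level.
- have [S0j|/(contra_not (@S0P _)) nS0j] := pselect (S0 (x - a j)).
    have [i hi] : exists i, hole i (x - a j).
      apply: contrapT => nh; apply: nSj; rewrite SE; split=> // -[i _ hi].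
      by apply: nh; exists i.
    have iL : i \in L.
      rewrite mem_filter mem_enum andbT; apply/asboolPn => cong.
      have : S (x - a n) by [].
      rewrite SE => -[_]; apply; exists i => //.
      have -> : x - a n = (x - a j) + (a j - a n) by rewrite addrA subrK.
      exact: hole_shift.
    have -> : h j x = 0; last by rewrite mulr0 mul0r.
    rewrite /h (big_rem i) //=.
    have -> : dot x (l i) = dot (b i + a j) (l i); last by rewrite subrr mul0r.
    have [y hy xE] := hi; rewrite -[x](subrK (a j)) -xE !dotD.
    suff -> : dot y (l i) = 0 by rewrite addr0.
    move: y hy {xE}; apply: group_gen_min => [|y z yl zl|y /(LP i iL).1//].
      exact: dot0.
    by rewrite dotB yl zl subrr.
  have [u uF nv] : exists2 u, u \in Fs & ~ vals u (dot (x - a j) u).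
    apply: contrapT => nu; apply: nS0j => u uF; apply: contrapT => nv.
    by apply: nu; exists u.
  have v : vals u (dot (x - a n) u) by exists (x - a n) => //; apply: SS0.
  move: v nv; rewrite !dotB => v nv.
  have ge := vals_ge uF v.
  have lt : dot x u - dot (a j) u < (c u)%:Z.
    by rewrite ltNge; apply/negP => /(vals_large uF).
  have pE : (u, dot x u) \in E n /\ (u, dot x u) \notin E j.
    have [ac|ai|ad] := aF u uF.
    - by exfalso; move: (ac n j) v => /= anj; rewrite /a /= anj.
    - exfalso; move: (ai j n jn) ge lt => /=; rewrite /a /=.
      by move: (c u) (dot x u) (dot _ u) (dot _ u) => z1 z2 z3 z4; lia.
    split; last by apply/negP => /(EP j).2[].
    apply/(EP n).2; split=> //= v0; apply: nv.
    apply: vals_large => //; have := vals_ge uF v0; move: (ad.1 j); rewrite /a /=.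
    by move: (c u) (dot x u) (dot _ u) => z1 z2 z3; lia.
  rewrite (big_rem (u, dot x u)) /=; last by case: pE.
  by rewrite (proj2 pE) subrr mul0r mulr0.
have -> : f0 (phi n) x = f n x by [].
rewrite (gP n).2 -gaE rE rmorph_sum mulr_sumr; apply: eq_bigr => j _.
have -> : f0 (phi j) x = f j x by [].
rewrite (gP j).2 !rmorphM /= hE gaE.
rewrite (bigID (mem (E j))) /=.
have -> : \prod_(p <- E n | p \in E j) ((dot x p.1)%:~R - p.2%:~R) =
    \prod_(p <- E j) ((dot x p.1)%:~R - p.2%:~R) :> K.
  rewrite -big_filter; apply: perm_big; apply: uniq_perm.
  - by rewrite filter_uniq //; have [] := EP n.
  - by have [] := EP j.
  move=> p; rewrite mem_filter; apply/andP/idP => [[]//|pj].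
  by split=> //; apply: Emono pj.
by ring.
Qed.

End Reduction.

(** * Facets and their integral forms *)

Section Geometry.
Variables (R : realType) (d : nat) (A : {fset 'rV[int]_d}).
Hypothesis ZA_full : ZA A = [set: 'rV[int]_d].
Local Notation V := 'rV[int]_d.
Local Notation C := (cone R A).
Implicit Types (sigma : set 'rV[R]_d) (l F : {scalar 'rV[R]_d}) (u : 'cV[int]_d).

Lemma toRD (x y : V) : toR R (x + y) = toR R x + toR R y.
Proof. exact: map_mxD. Qed.
Lemma toRN (x : V) : toR R (- x) = - toR R x.
Proof. exact: map_mxN. Qed.
Lemma toR0 : toR R (0 : V) = 0.
Proof. exact: map_mx0. Qed.

Lemma ZA_ind (P : V -> Prop) :
  P 0 -> (forall x y, P x -> P y -> P (x - y)) -> (forall a, a \in A -> P a) ->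
  forall x, P x.
Proof.
move=> P0 PB PA x; have : ZA A x by rewrite ZA_full.
exact: group_gen_min.
Qed.

Lemma cone_gen a : a \in A -> C (toR R a).
Proof.
move=> aA; exists (fun x => (x == a)%:R).
  by move=> x /=; case: eqP.
rewrite (big_fsetD1 a) //= eqxx scale1r big1_seq ?addr0 // => x.
by rewrite !inE => /andP[_ /andP[/negPf-> _]]; rewrite scale0r.
Qed.

(** The form that defines a face is nonnegative on [A], so a point of the face
    is a combination of elements of [A] on the face. *)
Lemma face_form_eq0 sigma (h : {scalar 'rV[R]_d}) : face C sigma ->
  (forall a, a \in A -> sigma (toR R a) -> h (toR R a) = 0) ->
  forall y, sigma y -> h y = 0.
Proof.
move=> [l l0 ->] hA _ [[c c0 <-] ly0].
rewrite linear_sum big_seq big1 // => a aA; rewrite linearZ /=.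
have tm x : x \in A -> 0 <= c x * l (toR R x).
  by move=> xA; apply: mulr_ge0; [apply: c0 | apply/l0/cone_gen].
have : c a * l (toR R a) = 0.
  move/eqP: ly0; rewrite linear_sum big_seq psumr_eq0 => [/allP/(_ a aA)|x xA].
    by rewrite aA linearZ => /eqP.
  by rewrite linearZ; apply: tm.
move/eqP; rewrite mulf_eq0 => /orP[/eqP->|/eqP la]; first by rewrite mul0r.
by rewrite hA ?mulr0 //; split=> //; apply: cone_gen.
Qed.

Definition facet_form u sigma : Prop :=
  facet C sigma /\ exists2 F, support_fun C sigma F &
    forall x, F (toR R x) = (dot x u)%:~R.

Lemma scalar_delta (h : {scalar 'rV[R]_d}) y :
  h y = \sum_j y 0 j * h (delta_mx 0 j).
Proof.
by rewrite {1}(row_sum_delta y) linear_sum; apply: eq_bigr => j _; rewrite linearZ.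
Qed.

Lemma support_fun_form sigma F : support_fun C sigma F ->
  exists u, forall x, F (toR R x) = (dot x u)%:~R.
Proof.
move=> [_ _ Fint].
have /choice[z zE] : forall j : 'I_d, exists z : int, z%:~R = F (delta_mx 0 j).
  move=> j; have : [set F (toR R a) | a in [set: V]] (F (delta_mx 0 j)).
    by exists (delta_mx 0 j) => //; rewrite /toR map_delta_mx.
  by rewrite Fint => -[z _ zE]; exists z.
exists (\col_j z j) => x; rewrite scalar_delta dotE rmorph_sum.
by apply: eq_bigr => j _; rewrite !mxE rmorphM /= zE.
Qed.

Lemma form_scalar u : exists h : {scalar 'rV[R]_d},
  (forall y, h y = (y *m map_mx intr u) 0 0) /\
  forall x, h (toR R x) = (dot x u)%:~R.
Proof.
pose h (y : 'rV[R]_d) : R := (y *m map_mx intr u) 0 0.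
have hlin : linear_for *%R h.
  by move=> k y z; rewrite /h mulmxDl -scalemxAl !mxE.
pose hL : {scalar 'rV[R]_d} := HB.pack h (GRing.isLinear.Build _ _ _ _ h hlin).
exists hL; split=> // x; rewrite /= /h /toR -map_mxM.
by rewrite mxE.
Qed.

Section FacetForm.
Variables (u : 'cV[int]_d) (sigma : set 'rV[R]_d).
Hypothesis usigma : facet_form u sigma.

Lemma facet_form_prim : exists e, dot e u = 1.
Proof.
have [_ [F [_ _ Fint] FE]] := usigma.
have : [set z%:~R | z in [set: int]] (1 : R) by exists 1.
rewrite -Fint => -[e _]; rewrite FE => /eqP.
by rewrite -[1]/(1%:~R) eqr_int => /eqP; exists e.
Qed.

Lemma facet_form_ge0 a : a \in A -> 0 <= dot a u.
Proof.
have [_ [F [F0 _ _] FE]] := usigma.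
by move=> /cone_gen/F0; rewrite FE ler0z.
Qed.

Lemma facet_form_eq0 a : sigma (toR R a) -> dot a u = 0.
Proof.
have [_ [F [_ F0 _] FE]] := usigma.
by move=> /F0; rewrite FE => /eqP; rewrite intr_eq0 => /eqP.
Qed.

(** The facet spans the kernel of its form, by counting dimensions; hence so
    do, up to finite index, the elements of [A] on the facet. *)
Lemma facet_form_kernel x : dot x u = 0 ->
  exists2 M, (0 < M)%N & face_group A sigma (x *+ M).
Proof.
move=> xu; have [[fc [k [M1 [free1 _ sub1]] [M2 [free2 sig2 _]]]] [F [_ F0 _] FE]] := usigma.
have [e eu] := facet_form_prim.
have dk : d = k.+1.
  have full y : (toR R y <= M1)%MS.
    move: y; apply: ZA_ind => [|y z hy hz|a /cone_gen/sub1//].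
      by rewrite toR0 sub0mx.
    by rewrite toRD toRN addmx_sub // (eqmx_opp _).
  have : (1%:M <= M1)%MS.
    apply/row_subP => j; have := full (delta_mx 0 j).
    by rewrite /toR map_delta_mx rowE mulmx1.
  rewrite sub1mx /row_full => /eqP <-.
  by move: free1; rewrite /row_free => /eqP.
have [h [hE hZ]] := form_scalar u.
have vn0 : map_mx intr u != 0 :> 'cV[R]_d.
  apply/eqP => u0; have := hZ e; rewrite hE u0 mulmx0 mxE eu => /eqP.
  by rewrite eq_sym oner_eq0.
have FhE y : F y = h y.
  rewrite scalar_delta [RHS]scalar_delta; apply: eq_bigr => j _; congr (_ * _).
  by have := FE (delta_mx 0 j); rewrite /toR map_delta_mx => ->; rewrite -hZ /toR map_delta_mx.
have M2u : (M2 <= kermx (map_mx intr u : 'cV[R]_d))%MS.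
  apply/row_subP => i; apply/sub_kermxP/matrixP => i' j'.
  by rewrite !ord1 -hE -FhE F0 // mxE.
have ker2 : (M2 == kermx (map_mx intr u : 'cV[R]_d))%MS.
  rewrite -(geq_leqif (mxrank_leqif_eq M2u)) mxrank_ker.
  have -> : \rank M2 = k by move: free2; rewrite /row_free => /eqP.
  have : (0 < \rank (map_mx intr u : 'cV[R]_d))%N by rewrite lt0n mxrank_eq0.
  by move: dk; lia.
have [M [Lm [M0 XL satX]]] := saturation [seq a <- A | `[< sigma (toR R a) >]].
exists M => //.
have -> : face_group A sigma = group_gen [set a | a \in [seq a <- A | `[< sigma (toR R a) >]]].
  congr group_gen; apply/seteqP; split=> a /=; rewrite mem_filter.
    by move=> [-> h2]; rewrite andbT; apply/asboolP.
  by move=> /andP[/asboolP].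
apply: satX => s.
have [g [gE gZ]] := form_scalar (Lm s).
have g0 y : sigma y -> g y = 0.
  apply: face_form_eq0 => // a aA sa; rewrite gZ XL // mem_filter aA andbT.
  exact/asboolP.
have : (toR R x <= M2)%MS.
  rewrite (eqmxP ker2); apply/sub_kermxP/matrixP => i j.
  by rewrite !ord1 -hE hZ xu mxE.
move=> /submxP[D DE]; have /eqP := gZ x; rewrite gE DE -mulmxA.
have -> : M2 *m map_mx intr (Lm s) = 0.
  apply/matrixP => i j; rewrite ord1 [RHS]mxE.
  have := g0 _ (sig2 i); rewrite gE => <-.
  by rewrite -row_mul [RHS]mxE.
by rewrite mulmx0 mxE eq_sym intr_eq0 => /eqP.
Qed.

End FacetForm.

(** Primitive forms with nested kernels agree up to sign, and the sign is fixed
    by nonnegativity on [A], which spans the lattice. *)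
Lemma facet_form_inj u u' sigma sigma' :
  facet_form u sigma -> facet_form u' sigma' ->
  (forall x, dot x u = 0 -> dot x u' = 0) -> u = u'.
Proof.
move=> hu hu' ker.
have [e eu] := facet_form_prim hu; have [e' eu'] := facet_form_prim hu'.
have prop x : dot x u' = dot x u * dot e u'.
  apply/eqP; rewrite -subr_eq0 mulrC -dotMz -dotB; apply/eqP/ker.
  by rewrite dotB dotMz eu mul1r subrr.
have : dot e u' = 1 \/ dot e u' = -1.
  have := congr1 absz (prop e'); rewrite eu' abszM => /esym/eqP.
  by rewrite muln_eq1 => /andP[_]; move: (dot e u') => z; lia.
case=> ce.
  apply/matrixP => j i; rewrite ord1.
  have := prop (delta_mx 0 j); rewrite ce mulr1 /dot -!rowE !mxE => ->.
  by [].
have z0 x : dot x u = 0.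
  move: x; apply: ZA_ind => [|x y hx hy|a aA].
  - exact: dot0.
  - by rewrite dotB hx hy subrr.
  have := facet_form_ge0 hu aA; have := facet_form_ge0 hu' aA.
  by rewrite prop ce; move: (dot a u) => z; lia.
by move: eu; rewrite z0.
Qed.

Lemma facet_form_indep u u' sigma sigma' :
  facet_form u sigma -> facet_form u' sigma' -> u <> u' ->
  exists2 y, dot y u = 0 & dot y u' != 0.
Proof.
move=> hu hu' uu'; apply: contrapT => ny; apply: uu'.
apply: (facet_form_inj hu hu') => x xu; apply/eqP/contraT => xu'.
by exfalso; apply: ny; exists x.
Qed.

(** A facet is determined by the elements of [A] that it contains. *)
Lemma finite_facet_forms : exists Fs : seq 'cV[int]_d,
  forall u, u \in Fs <-> exists sigma, facet_form u sigma.
Proof.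
pose P (X : {fset V}) u := exists2 sigma, facet_form u sigma &
  forall a, a \in A -> sigma (toR R a) <-> a \in X.
pose Fs0 := [seq xget 0 (P X) | X <- fpowerset A].
exists [seq u <- Fs0 | `[< exists sigma, facet_form u sigma >]] => u.
split=> [|[sigma us]]; first by rewrite mem_filter => /andP[/asboolP].
rewrite mem_filter; apply/andP; split; first by apply/asboolP; exists sigma.
pose X := [fset a in A | `[< sigma (toR R a) >]]%fset.
have PX : P X u.
  exists sigma => // a aA; by rewrite !inE aA /=; split=> /asboolP.
apply/mapP; exists X; first by rewrite fpowersetE; apply/fsubsetP => a; rewrite !inE => /andP[].
have [sigma' us' s'X] := xgetI 0 PX.
apply: (facet_form_inj us us') => x /(facet_form_kernel us)[M M0 hM].
have : dot (x *+ M) (xget 0 (P X)) = 0.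
  move: (x *+ M) hM; apply: group_gen_min => [|y z hy hz|a [aA sa]].
  - exact: dot0.
  - by rewrite dotB hy hz subrr.
  apply: (facet_form_eq0 us'); apply/s'X => //.
  by rewrite !inE aA; apply/asboolP.
by move=> /eqP; rewrite dotMn mulrn_eq0 -[M == _]negbK -lt0n M0 => /eqP.
Qed.

Lemma facet_form_NA_ge0 u sigma a : facet_form u sigma -> NA A a -> 0 <= dot a u.
Proof.
move=> us; move: a; apply: monoid_gen_min => [|x y hx hy|a aA].
- by rewrite dot0.
- by rewrite dotD addr_ge0.
- exact: (facet_form_ge0 us).
Qed.

(** The values of a facet form on NA form a numerical monoid containing two
    consecutive integers p, p + 1, hence all integers from p^2 on. *)
Lemma facet_form_vals (T : set V) u sigma : facet_form u sigma ->
  NA_set A T -> NA_fin_gen A T -> T !=set0 ->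
  exists c : nat, (forall n, vals T u n -> - c%:Z <= n) /\
                  (forall n, c%:Z <= n -> vals T u n).
Proof.
move=> us TNA [G TG] [s0 Ts0].
have [e eu] := facet_form_prim us.
have [v [v' [hv hv' eE]]] : exists v v', [/\ NA A v, NA A v' & e = v - v'].
  by apply: group_gen_diff; rewrite -/(ZA A) ZA_full.
have v'0 := facet_form_NA_ge0 us hv'.
pose p := absz (dot v' u).
have v'E : dot v' u = p%:Z by rewrite /p gez0_abs.
have vE : dot v u = (p.+1)%:Z by move: eu; rewrite eE dotB v'E; lia.
pose cG := \sum_(g <- G) absz (dot g u).
exists (cG + absz (dot s0 u) + p * p)%N; split=> [_ [x Tx <-]|n].
  move: Tx; rewrite TG => -[g [a [gG aNA ->]]]; rewrite dotD.
  have := facet_form_NA_ge0 us aNA.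
  rewrite /cG (big_rem g) //=; move: (\sum_(y <- _) _)%N (p * p)%N => z1 z2.
  by move: (dot g u) (dot a u) (absz (dot s0 u)) => y1 y2 y3; lia.
move=> cn; pose N := absz (n - dot s0 u).
have [nE pN] : n = dot s0 u + N%:Z /\ (p * p <= N)%N.
  rewrite /N; move: cn; move: cG (dot s0 u) (p * p)%N => z1 z2 z3; lia.
exists (s0 + (v' *+ (N %/ p - N %% p) + v *+ (N %% p))).
  by apply: TNA => //; apply: monoid_genD; apply: monoid_genMn.
rewrite !dotD !dotMn v'E vE nE; congr (_ + _).
have lt : (p != 0 -> N %% p <= N %/ p)%N.
  rewrite -lt0n => p0; apply: (@leq_trans p); first by rewrite ltnW ?ltn_mod.
  by rewrite leq_divRL.
have := divn_eq N p; case: (eqVneq p 0%N) lt => [->|p0 /(_ erefl)] => [_|].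
  by rewrite !modn0; lia.
by move: (N %/ p)%N (N %% p)%N => q r; nia.
Qed.

End Geometry.

(** * The theorem *)

Lemma coefficients_reduce_set0 (K : fieldType) (d : nat) :
  coefficients_reduce K (set0 : set 'rV[int]_d).
Proof.
move=> a f fpoly _; exists id => //.
have [A [iota [ev [nA _ evp evs]]]] := noetherian_cover K d.
have /choice[ga gaE] k : exists z, forall x, ev x z = f k x by apply: evs.
have [n /(_ n (leqnn n))[r rE]] := nA ga.
exists n, (fun j x => ev x (r j)); split=> // x.
rewrite -gaE rE rmorph_sum; apply: eq_bigr => j _.
by rewrite rmorphM /= gaE mulrC.
Qed.

(** If all integral forms that vanish on the lattice points of the face vanished
    at [v], a multiple of [v] would lie in the group of the face; the form
    defining the face would vanish at [v], and [v] would lie on the face. *)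
Lemma separate_from_face (R : realType) (d : nat) (A : {fset 'rV[int]_d})
    (tau : set 'rV[R]_d) (v : 'rV[int]_d) :
  face (cone R A) tau -> v \in A -> ~ tau (toR R v) ->
  exists2 l, forall x, face_group A tau x -> dot x l = 0 & dot v l != 0.
Proof.
move=> [h h0 tauE] vA nv.
have [M [Lm [M0 XL satX]]] := saturation [seq a <- A | `[< tau (toR R a) >]].
have grpE : face_group A tau =
    group_gen [set a | a \in [seq a <- A | `[< tau (toR R a) >]]].
  congr group_gen; apply/seteqP; split=> a /=; rewrite mem_filter.
    by move=> [-> ht]; rewrite andbT; apply/asboolP.
  by move=> /andP[/asboolP].
have [s vs] : exists s, dot v (Lm s) != 0.
  apply: contrapT => /forallNP ns; apply: nv; rewrite tauE.
  split; first exact: cone_gen.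
  have h_grp w : face_group A tau w -> h (toR R w) = 0.
    move: w; apply: group_gen_min => [|x y hx hy|a [_]].
    - by rewrite toR0 linear0.
    - by rewrite toRD toRN linearB hx hy subrr.
    - by rewrite tauE => -[].
  have /h_grp : face_group A tau (v *+ M).
    by rewrite grpE; apply: satX => s; apply/eqP/contraT => vs; case: (ns s).
  have -> : toR R (v *+ M) = toR R v *+ M.
    by apply/rowP => j; rewrite !mxE !mulmxnE !mxE rmorphMn.
  by move/eqP; rewrite raddfMn mulrn_eq0 -[M == _]negbK -lt0n M0 => /eqP.
exists (Lm s) => // x; rewrite grpE; move: x; apply: group_gen_min => [|x y hx hy|a /XL//].
- exact: dot0.
- by rewrite dotB hx hy subrr.
Qed.

Section Density.
Variables (R : realType) (K : fieldType) (charK : [pchar K] =i pred0).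
Variables (d : nat) (A : {fset 'rV[int]_d}) (S0 S : set 'rV[int]_d).
Hypothesis ZA_full : ZA A = [set: 'rV[int]_d].
Hypothesis S0_NA : NA_set A S0.
Variables (m : nat) (b : 'I_m -> 'rV[int]_d) (tau : 'I_m -> set 'rV[R]_d).
Hypothesis face_tau : forall i, face (cone R A) (tau i).
Hypothesis SE : S = S0 `\` \bigcup_(i in [set: 'I_m])
                             translate (b i) (face_group A (tau i)).

(** If [S] meets a hyperplane parallel to a facet, it is Zariski dense in it:
    starting from a point x0 of [S], adding elements of the facet monoid
    leaves [S] only by entering holes whose face does not contain the facet;
    these lie in proper linear sections of the hyperplane. *)
Lemma facet_levels_dense u (sigma : set 'rV[R]_d) n (f : 'rV[int]_d -> K) x0 :
  facet_form A u sigma -> S x0 -> dot x0 u = n -> polyfun f ->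
  (forall x, S x -> level u n x -> f x = 0) -> forall x, level u n x -> f x = 0.
Proof.
move=> us Sx0 x0u fpoly f0.
pose bad i := exists2 v, v \in A /\ sigma (toR R v) & ~ tau i (toR R v).
have /choice[l lP] i : exists l, bad i ->
    (forall x, face_group A (tau i) x -> dot x l = 0) /\
    exists2 v, sigma (toR R v) & dot v l != 0.
  have [[v [vA sv] nv]|nb] := pselect (bad i); last by exists 0.
  have [l l0 vl] := separate_from_face (face_tau i) vA nv.
  by exists l => _; split=> //; exists v.
pose q x : K := \prod_(i | `[< bad i >]) ((dot x (l i))%:~R - (dot (b i) (l i))%:~R).
have qpoly : polyfun q by apply: polyfun_prod => i _; apply: polyfun_level.
pose X : set 'rV[int]_d := [set a | a \in A /\ sigma (toR R a)].
have fq0 w : monoid_gen X w -> f (x0 + w) * q (x0 + w) = 0.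
  move=> hw.
  have wu : level u n (x0 + w).
    rewrite /level /= dotD x0u; suff -> : dot w u = 0 by rewrite addr0.
    move: w hw; apply: monoid_gen_min => [|x y hx hy|a [_ sa]].
    - exact: dot0.
    - by rewrite dotD hx hy addr0.
    - exact: (facet_form_eq0 us).
  have [Sw|nSw] := pselect (S (x0 + w)); first by rewrite f0 ?mul0r.
  move: Sx0; rewrite SE => -[S0x0 nx0].
  have S0w : S0 (x0 + w).
    apply: S0_NA => //; move: w hw {wu nSw}; apply: monoid_gen_min => [|x y hx hy|a [aA _]].
    - exact: monoid_gen0.
    - exact: monoid_genD.
    - exact: sub_monoid_gen.
  have [i [h hh hE]] : exists i, translate (b i) (face_group A (tau i)) (x0 + w).
    apply: contrapT => nh; apply: nSw; rewrite SE; split=> // -[i _ hi].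
    by apply: nh; exists i.
  have [ib|nb] := pselect (bad i).
    rewrite /q (bigD1 i) /=; last exact/asboolP.
    by rewrite -hE dotD ((lP i ib).1 h hh) addr0 subrr mul0r mulr0.
  exfalso; apply: nx0; exists i => //; exists (h - w); last by rewrite addrA hE addrK.
  apply: group_genB => //; move: w hw {wu nSw S0w hE}.
  apply: monoid_gen_min => [|x y hx hy|a [aA sa]].
  - exact: group_gen0.
  - exact: group_genD.
  apply: sub_group_gen; split=> //; apply: contrapT => na.
  by apply: nb; exists a.
have fqpoly : polyfun (fun x => f x * q x) by apply: polyfunM.
have fq_level x : level u n x -> f x * q x = 0.
  move=> xu; have [|M M0] := facet_form_kernel ZA_full us (x := x - x0).
    by rewrite dotB xu x0u subrr.
  move=> /group_gen_diff[w [w' [hw hw' wE]]].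
  (* The points x0 + t w + s t w' are zeros for natural s, hence for s = -1. *)
  have ray t : f (x0 + (x - x0) *+ M *+ t) * q (x0 + (x - x0) *+ M *+ t) = 0.
    have := polyfun_ray charK (x := x0 + w *+ t) (y := w' *+ t) fqpoly _ (-1).
    rewrite mulrN1z wE mulrnBl -addrA; apply=> k.
    rewrite -addrA; apply: fq0; apply: monoid_genD; first exact: monoid_genMn.
    by do 2 apply: monoid_genMn.
  (* [ray] gives zeros at every M-th lattice point from x0 on towards x. *)
  have [p pE] := polyfun_line x0 (x - x0) fqpoly.
  have p0 : p \Po (M%:R *: 'X) = 0.
    apply: (poly_eq0_nat charK) => t.
    rewrite horner_comp !hornerE -natrM -[_%:R]/((M * t)%N%:Z%:~R) -pE -pmulrn mulrnA.
    exact: ray.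
  have : p.[1%:~R] = 0.
    have := congr1 (fun r => r.[M%:R^-1]) p0; rewrite horner_comp !hornerE divff //.
    by rewrite natr_eq0_char0 // -lt0n.
  by rewrite -pE mulr1z subrKC.
apply: (line_irreducible_prod charK (@level_line _ u n) fpoly
  (r := index_enum 'I_m) (P := fun i => `[< bad i >])
  (g := fun i x => (dot x (l i))%:~R - (dot (b i) (l i))%:~R)) => //.
  by move=> i; apply: polyfun_level.
move=> i /asboolP/(lP i)[_ [v sv vl]].
have [e|ne] := eqVneq (dot x0 (l i)) (dot (b i) (l i)).
  exists (x0 + v); first by rewrite /level /= dotD x0u (facet_form_eq0 us sv) addr0.
  by rewrite level_vanish // dotD e -subr_eq0 addrAC subrr add0r.
by exists x0 => //; rewrite level_vanish.
Qed.

End Density.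

Theorem theorem5p10 (R : realType) (K : closedFieldType)
  (charK : [pchar K] =i pred0)
  (d : nat) (A : {fset 'rV[int]_d})
  (ZA_full : ZA A = [set: 'rV[int]_d])
  (A_convex : strongly_convex (cone R A))
  (S0 : set 'rV[int]_d)
  (S0_NA : NA_set A S0) (S0_fg : NA_fin_gen A S0) (S0_scored : scored R A S0)
  (m : nat) (b : 'I_m -> 'rV[int]_d) (tau : 'I_m -> set 'rV[R]_d)
  (bS0 : forall i, S0 (b i)) (face_tau : forall i, face (cone R A) (tau i))
  (Sm : set 'rV[int]_d)
  (SmE : Sm = S0 `\` \bigcup_(i in [set: 'I_m])
                       translate (b i) (face_group A (tau i)))
  (irr : irredundant S0 (fun i => translate (b i) (face_group A (tau i))))
  (F_Sm : forall (sigma : set 'rV[R]_d) (F : {scalar 'rV[R]_d}),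
     facet (cone R A) sigma -> support_fun (cone R A) sigma F ->
     image_support F Sm = image_support F S0) :
  right_noetherian (diffop_on K Sm).
Proof.
apply: right_noetherian_criterion.
have [->|/set0P[s Ss]] := eqVneq Sm set0; first exact: coefficients_reduce_set0.
have S0_nonempty : S0 !=set0 by exists s; move: Ss; rewrite SmE => -[].
have [Fs FsP] := finite_facet_forms R ZA_full.
have formP u : u \in undup Fs -> exists sigma, @facet_form R d A u sigma.
  by rewrite mem_undup => /FsP.
have /choice[c cP] : forall u, exists c : nat, u \in undup Fs ->
    (forall n, vals S0 u n -> - c%:Z <= n) /\ (forall n, c%:Z <= n -> vals S0 u n).
  move=> u; have [uF|] := boolP (u \in undup Fs); last by exists 0%N.
  have [sigma us] := formP u uF.
  by have [c hc] := facet_form_vals ZA_full us S0_NA S0_fg S0_nonempty; exists c.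
pose X i := [seq a <- A | `[< tau i (toR R a) >]].
apply: (@facets_and_holes_reduce K charK d S0 Sm (undup Fs) c _ _ _ _ _ m b X).
- by move=> u /formP[sigma us]; apply: facet_form_prim us.
- move=> u u' /formP[sigma us] /formP[sigma' us'].
  exact: (facet_form_indep ZA_full us us').
- move=> x xv; rewrite S0_scored => sigma F hs hF.
  have [u uE] := support_fun_form hF.
  have [|y S0y yx] := xv u.
    by rewrite mem_undup; apply/FsP; exists sigma; split=> //; exists F.
  by exists y => //; rewrite !uE yx.
- by move=> u n /cP[+ _]; apply.
- by move=> u n /cP[_]; apply.
- rewrite SmE; congr (_ `\` _); apply: eq_bigcupr => i _.
  congr (translate _ (group_gen _)); apply/seteqP; split=> a /=; rewrite mem_filter.
    by move=> [-> ht]; rewrite andbT; apply/asboolP.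
  by move=> /andP[/asboolP].
move=> u n f /formP[sigma us] [y S0y yn] fpoly f0.
have [hs [F hF FE]] := us.
have : image_support F S0 (F (toR R y)) by exists y.
rewrite -(F_Sm _ _ hs hF) => -[x0 Sx0]; rewrite !FE => /eqP; rewrite eqr_int => /eqP x0y.
apply: (facet_levels_dense charK ZA_full S0_NA face_tau SmE us Sx0 _ fpoly f0).
by rewrite x0y.
Qed.
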